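(* Assume ZFC together with the continuum hypothesis $2^{\aleph_0}=\aleph_1$. Let $R$ be a countable principal ideal domain which is not a field. Then there is a family of $2^{\aleph_1}$ pairwise non-isomorphic reflexive $R$-modules $G$ of cardinality $\aleph_1$ such that $G\not\cong R\oplus G$.
   Context: For an $R$-module $G$ put $G^*=\operatorname{Hom}_R(G,R)$. The evaluation map $\sigma_G: G\to G^{**}$ sends $g\in G$ to the homomorphism $\sigma_G(g): G^*\to R$, $\varphi\mapsto\varphi(g)$. The module $G$ is called reflexive if $\sigma_G$ is an isomorphism. *)

(* Defs.v *)
From HB Require Import structures.
From mathcomp Require Import all_boot all_algebra.
From mathcomp Require Import all_classical.
From mathcomp Require Import wochoice.

Set Implicit Arguments.
Unset Strict Implicit.
Unset Printing Implicit Defensive.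

Import GRing.Theory.

Local Open Scope classical_set_scope.
Local Open Scope card_scope.
Local Open Scope ring_scope.

(* T is equipotent with omega_1, the order type of an uncountable well-order
   all of whose proper initial segments are countable. *)
Definition card_aleph1 (T : Type) : Prop :=
  exists le : rel T,
    [/\ well_order le,
        ~ countable [set: T] &
        forall x : T, countable [set y | le y x /\ y <> x]].

Definition card_two_pow_aleph1 (T : Type) : Prop :=
  exists2 W : Type, card_aleph1 W & [set: T] #= [set: set W].

Definition continuum_hypothesis : Prop := card_aleph1 (set nat).

(* Ideals of R are the submodules of the regular module R^o. *)
Definition principal_ideal_domain (R : idomainType) : Prop :=
  forall I : {pred R^o}, GRing.submod_closed I ->
    exists a : R, forall x : R, x \in I <-> exists b : R, x = b * a.

Definition isomorphic (R : pzRingType) (U V : lmodType R) : Prop :=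
  exists f : {linear U -> V}, bijective f.

Definition dual (R : comNzRingType) (G : lmodType R) : Type :=
  {linear G -> R^o}.

Section DualModule.
Variables (R : comNzRingType) (G : lmodType R).
Implicit Types (f g h : dual G) (a b : R).

HB.instance Definition _ := gen_eqMixin (dual G).
HB.instance Definition _ := gen_choiceMixin (dual G).

Lemma dual_ext f g : (forall x, f x = g x) -> f = g.
Proof.
case: f g => [f [[cf0] [cfD]]] [g [[cg0] [cgD]]] /= /funext fg.
subst g; by rewrite (Prop_irrelevance cf0 cg0) (Prop_irrelevance cfD cgD).
Qed.

Definition dual0 : dual G := @GRing.null_fun G R^o.
Definition dual_add f g : dual G := f \+ g.
Definition dual_opp f : dual G := \- f.
Definition dual_scale a f : dual G := a \*: f.

Lemma dual_addA : associative dual_add.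
Proof. by move=> f g h; apply: dual_ext => x /=; rewrite addrA. Qed.

Lemma dual_addC : commutative dual_add.
Proof. by move=> f g; apply: dual_ext => x /=; rewrite addrC. Qed.

Lemma dual_add0 : left_id dual0 dual_add.
Proof. by move=> f; apply: dual_ext => x /=; rewrite add0r. Qed.

Lemma dual_addN : left_inverse dual0 dual_opp dual_add.
Proof. by move=> f; apply: dual_ext => x /=; rewrite addNr. Qed.

HB.instance Definition _ :=
  GRing.isZmodule.Build (dual G) dual_addA dual_addC dual_add0 dual_addN.

Lemma dual_scaleA a b f : dual_scale a (dual_scale b f) = dual_scale (a * b) f.
Proof. by apply: dual_ext => x /=; rewrite scalerA. Qed.

Lemma dual_scale1 : left_id 1 dual_scale.
Proof. by move=> f; apply: dual_ext => x /=; rewrite scale1r. Qed.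

Lemma dual_scaleDr : right_distributive dual_scale +%R.
Proof. by move=> a f g; apply: dual_ext => x /=; rewrite scalerDr. Qed.

Lemma dual_scaleDl f : {morph dual_scale^~ f : a b / a + b}.
Proof. by move=> a b; apply: dual_ext => x /=; rewrite scalerDl. Qed.

HB.instance Definition _ := GRing.Zmodule_isLmodule.Build R (dual G)
  dual_scaleA dual_scale1 dual_scaleDr dual_scaleDl.

End DualModule.

Section Evaluation.
Variables (R : comNzRingType) (G : lmodType R).

Definition eval_at (x : G) : dual G -> R^o := fun f => f x.

Lemma eval_at_linear (x : G) : linear (eval_at x).
Proof. by []. Qed.

HB.instance Definition _ (x : G) :=
  GRing.isLinear.Build R (dual G) R^o _ (eval_at x) (eval_at_linear x).

Definition sigma (x : G) : dual (dual G) := eval_at x.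

Lemma sigma_linear : linear sigma.
Proof. by move=> a x y; apply: dual_ext => f; exact: linearP. Qed.

HB.instance Definition _ :=
  GRing.isLinear.Build R G (dual (dual G)) _ sigma sigma_linear.

End Evaluation.

Definition reflexive_module (R : comNzRingType) (G : lmodType R) : Prop :=
  bijective (sigma (G := G) : {linear G -> dual (dual G)}).

(* Main.v *)
Require Import Defs.
From HB Require Import structures.
From mathcomp Require Import all_boot all_algebra.
From mathcomp Require Import all_classical.
From mathcomp Require Import wochoice.
From mathcomp Require Import ring.

(** Fix a nonzero nonunit [p] of [R]. Let [D] be the module of sequences over [R]
    tending to zero [p]-adically, and call two sequences orthogonal if the
    [p]-adic sum of the products of their entries lies in [R]. The modules sought
    are the perpendiculars [G] of suitable sets of sequences. If [G] and [perp G]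
    are both contained in [D], then functionals on them are [p]-adically
    continuous, so they are given by pairing with the sequence of their values on
    the unit vectors. Thus [perp G] is the dual of [G] and conversely, and [G] is
    reflexive ([perp_reflexive]).

    By the continuum hypothesis there are only [aleph_1] sequences and matrices
    over [R]. A recursion of length [omega_1] builds two increasing chains of
    countable subsets of [D], orthogonal to each other ([tree_construction]). At
    each stage there are countably many orthogonality conditions to respect, and
    new elements are obtained as series of finitely supported sequences multiplied
    by growing powers of [p], diagonalising against the countably many elements of
    [R] ([generic_pair]). This provides an element that is not orthogonal to a
    given sequence outside [D] ([kill_sequence]), which keeps the final
    perpendiculars inside [D]. It also provides a pair of elements which prevents
    a given matrix from acting on [G], unless the matrix is, on subspaces of
    finite corank, proportional to the identity ([kill_matrix],
    [bilin_proportional]).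

    Consequently every endomorphism of [G] is, up to a denominator, the sum of a
    scalar and an endomorphism of finite rank ([endo_scalar_plus_finite]), and an
    injective one has torsion cokernel ([endo_cokernel_torsion]). An isomorphism
    from [G] to [R * G] would give an injective endomorphism of [G] with cokernel
    [R].

    Every stage also offers a choice between two incompatible elements, so the
    [2 ^ aleph_1] branches of a binary tree yield pairwise distinct modules. An
    isomorphism out of a given module is determined by a matrix, so at most
    [aleph_1] of the modules are isomorphic to it, and a diagonal argument finds
    [2 ^ aleph_1] isomorphism classes ([many_classes]). *)

Set Implicit Arguments.
Unset Strict Implicit.
Unset Printing Implicit Defensive.

Import GRing.Theory.

Local Open Scope classical_set_scope.
Local Open Scope card_scope.
Local Open Scope ring_scope.

(** * The adic filtration of a principal ideal domain *)

Definition pdvd (R : idomainType) (p : R) (n : nat) (x : R) : Prop :=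
  exists c, x = p ^+ n * c.

Section PID.
Variable R : idomainType.
Hypothesis Rpid : principal_ideal_domain R.

Lemma pid_generator (J : set R) :
    J 0 -> (forall a x y, J x -> J y -> J (a * x + y)) ->
  exists2 d, J d & forall x, J x -> exists c, x = c * d.
Proof.
move=> J0 JD.
have [|d Jd] := Rpid (I := [pred x : R^o | `[< J x >]]).
  split; first by apply/asboolP.
  by move=> a x y /asboolP Jx /asboolP Jy; apply/asboolP; exact: JD.
exists d; last by move=> x Jx; apply/Jd; apply/asboolP.
by apply/asboolP/Jd; exists 1; rewrite mul1r.
Qed.

Variable p : R.
Hypotheses (p0 : p != 0) (pU : p \isn't a GRing.unit).

(** A generator [d] of the intersection of the ideals [p ^ n * R] is [p] times an
    element of that intersection, so [d = p * f * d] for some [f]. *)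
Lemma pid_adic_separated x : (forall n, pdvd p n x) -> x = 0.
Proof.
have [||d Id Jd] := @pid_generator (fun x => forall n, pdvd p n x).
- by move=> n; exists 0; rewrite mulr0.
- move=> a y z Iy Iz n; have [[c ->] [c' ->]] := (Iy n, Iz n).
  by exists (a * c + c'); ring.
have [e de] := Id 1; rewrite expr1 in de.
have [|f ef] := Jd e.
  move=> n; have [c dc] := Id n.+1; exists c; apply: (mulfI p0).
  by rewrite -de dc exprS mulrA.
have d0 : d = 0.
  apply/eqP; apply: contraT => dn0; case/negP: pU.
  apply/unitrP; exists f; suff: p * f = 1 by move=> pf; rewrite mulrC pf.
  by apply: (mulIf dn0); rewrite mul1r {2}de ef; ring.
by move=> /Jd [c ->]; rewrite d0 mulr0.
Qed.

(** Multiplication by [c] shifts the [p]-adic filtration boundedly: the ideal of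
    all [x] with [p ^ n * x] divisible by [c] for some [n] is principal, so one
    [k] serves for all [n]. *)
Lemma pid_adic_cancel c :
  c != 0 -> exists k, forall n x, pdvd p (n + k) (c * x) -> pdvd p n x.
Proof.
move=> c0.
have [||d [k [v kd]] Jd] :=
    @pid_generator (fun x => exists n c', p ^+ n * x = c * c').
- by exists 0, 0; rewrite !mulr0.
- move=> a x y [n [u nu]] [m [v mv]]; exists (n + m)%N, (p ^+ m * a * u + p ^+ n * v).
  transitivity (p ^+ m * a * (p ^+ n * x) + p ^+ n * (p ^+ m * y)).
    by rewrite exprD; ring.
  by rewrite nu mv; ring.
exists k => n x [u cu].
have [|w uw] := Jd u; first by exists (n + k)%N, x.
exists (w * v); apply: (mulfI c0).
by rewrite cu uw exprD -mulrA (mulrCA _ w) kd; ring.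
Qed.

End PID.

(** * Linear dependence over the field of fractions *)

Section Span.
Variables (R : idomainType) (V : lmodType R).
Implicit Types (l : seq V) (z : V).

Fixpoint span l z : Prop :=
  if l is y :: l' then exists k, span l' (z - k *: y) else z = 0.

(** Linear span over the field of fractions of [R], expressed inside [V]. *)
Definition qspan l z : Prop := exists2 c : R, c != 0 & span l (c *: z).

Lemma span0 l : span l 0.
Proof. by elim: l => //= y l IH; exists 0; rewrite scale0r subr0. Qed.

Lemma spanZD l a z z' : span l z -> span l z' -> span l (a *: z + z').
Proof.
elim: l z z' => [|y l IH] z z' /=; first by move=> -> ->; rewrite scaler0 addr0.
move=> [k sk] [k' sk']; exists (a * k + k').
rewrite scalerDl -scalerA opprD addrACA -scalerBr; exact: IH.
Qed.

Lemma spanZ l a z : span l z -> span l (a *: z).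
Proof. by move=> sz; rewrite -[_ *: _]addr0; apply: spanZD => //; exact: span0. Qed.

Lemma span_qspan l z : span l z -> qspan l z.
Proof. by move=> sz; exists 1; rewrite ?scale1r ?oner_neq0. Qed.

Lemma qspanZD l a z z' : qspan l z -> qspan l z' -> qspan l (a *: z + z').
Proof.
move=> [c c0 sz] [c' c'0 sz']; exists (c * c'); first by rewrite mulf_neq0.
have -> : (c * c') *: (a *: z + z') = (c' * a) *: (c *: z) + c *: (c' *: z').
  by rewrite scalerDr !scalerA; congr (_ *: _ + _ *: _); ring.
by apply: spanZD => //; exact: spanZ.
Qed.

Lemma qspan_div l c z : c != 0 -> qspan l (c *: z) -> qspan l z.
Proof.
by move=> c0 [c' c'0]; rewrite scalerA => ?; exists (c' * c); rewrite ?mulf_neq0.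
Qed.

Lemma span_cons l y z : span l z -> span (y :: l) z.
Proof. by exists 0; rewrite scale0r subr0. Qed.

Lemma span_catr l l' z : span l' z -> span (l ++ l') z.
Proof. by elim: l => //= y l IH sz; apply: span_cons; exact: IH. Qed.

Lemma span_catl l l' z : span l z -> span (l ++ l') z.
Proof.
elim: l z => [|y l IH] z /=; first by move->; exact: span0.
by move=> [k sk]; exists k; exact: IH.
Qed.

Lemma span_coef l z :
  span l z -> exists c : nat -> R, z = \sum_(i < size l) c i *: l`_i.
Proof.
elim: l z => [|y l IH] z /=; first by exists (fun=> 0); rewrite big_ord0.
move=> [k /IH [c zc]]; exists (fun i => if i is j.+1 then c j else k).
by rewrite big_ord_recl /= -zc addrC subrK.
Qed.

(** A square matrix with a zero column is singular, which bounds the rank over the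
    field of fractions by [size l]. *)
Lemma qspan_dependent l (z : nat -> V) :
    (forall i, qspan l (z i)) ->
  exists2 v : 'I_(size l).+1 -> R, exists i, v i != 0 & \sum_i v i *: z i = 0.
Proof.
move=> lz; set n := size l.
have /choice [c cP] (i : nat) : exists cc : R * (nat -> R), cc.1 != 0 /\
    cc.1 *: z i = \sum_(j < n) cc.2 j *: l`_j.
  by have [c c0 /span_coef [d dP]] := lz i; exists (c, d).
pose A : 'M[R]_n.+1 := \matrix_(i, j) if (j < n)%N then (c i).2 j else 0.
have /eqP/det0P [v v0 vA] : \det A = 0.
  rewrite (expand_det_col _ ord_max) big1 // => i _.
  by rewrite mxE /= ltnn mul0r.
exists (fun i => v 0 i * (c i).1).
  have [i vi] : exists i, v 0 i != 0.
    apply/not_existsP => vn; case/negP: v0; apply/eqP/rowP => i.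
    by rewrite mxE; apply/eqP/negPn/negP; exact: vn.
  by exists i; rewrite mulf_neq0 //; have [] := cP i.
under eq_bigr => i _.
  have [_ e] := cP i; rewrite -scalerA e scaler_sumr; over.
rewrite exchange_big big1 // => j _ /=.
under eq_bigr do rewrite scalerA.
rewrite -scaler_suml.
have := congr1 (fun B : 'rV_n.+1 => B 0 (widen_ord (leqnSn n) j)) vA.
rewrite !mxE => e; rewrite [X in X *: _](_ : _ = 0) ?scale0r // -[RHS]e.
by apply: eq_bigr => i _; rewrite mxE /= ltn_ord.
Qed.

End Span.

Lemma span_map (R : idomainType) (U V : lmodType R) (f : U -> V) l z :
    (forall a x y, f (a *: x + y) = a *: f x + f y) ->
  span l z -> span (map f l) (f z).
Proof.
move=> lf; elim: l z => [|y l IH] z /=.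
  by move->; have := lf (-1) 0 0; rewrite !scaleN1r oppr0 addr0 addNr.
by move=> [k /IH]; rewrite addrC -scaleNr lf scaleNr addrC; exists k.
Qed.

Section Functionals.
Variables (R : idomainType) (V : lmodType R).

Definition functional (f : V -> R) :=
  forall a x y, f (a *: x + y) = a * f x + f y.

Variables (f : V -> R) (lf : functional f).

Lemma functional0 : f 0 = 0.
Proof. by have := lf (-1) 0 0; rewrite scaler0 addr0 mulN1r addNr. Qed.

Lemma functionalD x y : f (x + y) = f x + f y.
Proof. by rewrite -{1}[x]scale1r lf mul1r. Qed.

Lemma functionalZ a x : f (a *: x) = a * f x.
Proof. by rewrite -[_ *: _]addr0 lf functional0 addr0. Qed.

Lemma functionalB x y : f (x - y) = f x - f y.
Proof. by rewrite -scaleN1r functionalD functionalZ mulN1r. Qed.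

Lemma functional_sum n (x : nat -> V) :
  f (\sum_(i < n) x i) = \sum_(i < n) f (x i).
Proof.
by elim: n => [|n IH]; rewrite ?big_ord0 ?functional0 // !big_ord_recr functionalD IH.
Qed.

End Functionals.

(** The common kernel of finitely many functionals has finite corank: each
    functional that does not vanish on the kernel of the later ones adds one
    vector of that kernel to [ws]. *)
Lemma ker_corank (R : idomainType) (V : lmodType R) (fs : seq (V -> R)) :
    (forall f, List.In f fs -> functional f) ->
  exists ws : seq V, forall g, exists2 c : R, c != 0 &
    exists2 u, span ws u & forall f, List.In f fs -> f (c *: g - u) = 0.
Proof.
elim: fs => [|f fs IH] lin.
  by exists [::] => g; exists 1; rewrite ?oner_neq0 //; exists 0.
have lf : functional f by apply: lin; left.
have [|ws {}IH] := IH; first by move=> f' ?; apply: lin; right.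
have [[w wK fw]|K] := pselect
    (exists2 w, forall f', List.In f' fs -> f' w = 0 & f w != 0).
  exists (w :: ws) => g; have [c c0 [u su uK]] := IH g.
  exists (f w * c); first by rewrite mulf_neq0.
  exists ((f w *: u) + f (c *: g - u) *: w).
    by exists (f (c *: g - u)); rewrite addrK; exact: spanZ.
  have -> : (f w * c) *: g - (f w *: u + f (c *: g - u) *: w) =
      f w *: (c *: g - u) - f (c *: g - u) *: w.
    by rewrite scalerBr scalerA opprD addrA.
  move=> f' f's; have lf' := lin _ f's; move: f's => /= [<-|f's].
    by rewrite functionalB // !functionalZ // mulrC subrr.
  by rewrite functionalB // !functionalZ // (uK _ f's) (wK _ f's) !mulr0 subrr.
exists ws => g; have [c c0 [u su uK]] := IH g; exists c => //; exists u => //.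
move=> f' /= [<-|]; last exact: uK.
apply/eqP; apply: contraT => fn0; case: K; exists (c *: g - u) => //.
Qed.

(** * Pairing with finitely supported sequences *)

Notation sqn R := (nat -> R^o).

Section Pairing.
Variable R : idomainType.
Implicit Types (a b : {poly R}) (x y z : sqn R).

Definition coefs a : sqn R := fun i => a`_i.

(** Finitely supported sequences are represented by polynomials. *)
Definition dotp a (y : nat -> R) : R := \sum_(i < size a) a`_i * y i.

Lemma dotpE N a (y : nat -> R) :
  (size a <= N)%N -> dotp a y = \sum_(i < N) a`_i * y i.
Proof.
move=> aN; rewrite /dotp (big_ord_widen N (fun i => a`_i * y i)) // big_mkcond.
apply: eq_bigr => i _; case: ltnP => // le_a_i.
by rewrite nth_default // mul0r.
Qed.

Lemma dotp_functionall (y : nat -> R) : functional (dotp^~ y).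
Proof.
move=> c a b; set N := maxn (size (c *: a + b)) (maxn (size a) (size b)).
rewrite !(@dotpE N) ?leq_max ?leqnn ?orbT //.
rewrite mulr_sumr -big_split; apply: eq_bigr => i _ /=.
by rewrite coefD coefZ mulrDl mulrA.
Qed.

Lemma dotp_functionalr a : functional (dotp a : sqn R -> R).
Proof.
move=> c x y; rewrite /dotp mulr_sumr -big_split; apply: eq_bigr => i _ /=.
by rewrite mulrDr mulrCA.
Qed.

Lemma dotpDl a b y : dotp (a + b) y = dotp a y + dotp b y.
Proof. exact: (functionalD (dotp_functionall y)). Qed.

Lemma dotpZl c a y : dotp (c *: a) y = c * dotp a y.
Proof. exact: (functionalZ (dotp_functionall y)). Qed.

Lemma dotpXn i (y : nat -> R) : dotp 'X^i y = y i.
Proof.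
rewrite /dotp size_polyXn big_ord_recr /= coefXn eqxx mul1r big1 ?add0r // => j _.
by rewrite coefXn ltn_eqF // mul0r.
Qed.

Lemma dotpC a b : dotp a (coefs b) = dotp b (coefs a).
Proof.
set N := maxn (size a) (size b).
rewrite !(@dotpE N) ?leq_max ?leqnn ?orbT //.
by apply: eq_bigr => i _; rewrite mulrC.
Qed.

Definition bilin (M : nat -> sqn R) a b : R := dotp a (fun i => dotp b (M i)).

Lemma bilinE M a b : bilin M a b = dotp b (fun j => dotp a (M^~ j)).
Proof.
rewrite /bilin /dotp; under eq_bigr do rewrite mulr_sumr.
rewrite exchange_big; apply: eq_bigr => j _ /=; rewrite mulr_sumr.
by apply: eq_bigr => i _; rewrite mulrCA.
Qed.

Lemma bilinDl M a a' b : bilin M (a + a') b = bilin M a b + bilin M a' b.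
Proof. exact: dotpDl. Qed.

Lemma bilinZl M c a b : bilin M (c *: a) b = c * bilin M a b.
Proof. exact: dotpZl. Qed.

Lemma bilinDr M a b b' : bilin M a (b + b') = bilin M a b + bilin M a b'.
Proof. by rewrite !bilinE dotpDl. Qed.

Lemma bilinZr M c a b : bilin M a (c *: b) = c * bilin M a b.
Proof. by rewrite !bilinE dotpZl. Qed.

Definition kills (ys : seq (sqn R)) a := forall y, List.In y ys -> dotp a y = 0.

Lemma kills_cat ys ys' a : kills (ys ++ ys') a <-> kills ys a /\ kills ys' a.
Proof.
split=> [k|[k k'] y y_in].
  by split=> y y_in; apply: k; apply/List.in_or_app; [left|right].
by case: (List.in_app_or _ _ _ y_in) => [/k|/k'].
Qed.

Lemma killsZD ys c a b : kills ys a -> kills ys b -> kills ys (c *: a + b).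
Proof. by move=> ka kb y yys; rewrite dotp_functionall ka ?kb // mulr0 addr0. Qed.

Lemma kills0 ys : kills ys 0.
Proof. by move=> y _; exact: (functional0 (dotp_functionall y)). Qed.

(** Duality, by induction on [ys]: if some [v] killing the later members pairs
    nontrivially with the first one, then subtracting a multiple of the first one
    from a multiple of [z] makes the pairing with [v] vanish. *)
Lemma qspan_of_kills ys z :
  (forall a, kills ys a -> dotp a z = 0) -> qspan ys z.
Proof.
elim: ys z => [|y ys IH] z zK.
  apply: span_qspan; apply/funext => i; rewrite -[LHS](dotpXn i) zK //.
have [[v vK vy]|K] := pselect (exists2 v, kills ys v & dotp v y != 0).
  have [|c c0 sc] := IH (dotp v y *: z - dotp v z *: y).
    move=> u uK; have := zK (dotp v y *: u + (- dotp u y) *: v).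
    have ly := dotp_functionall y; have lz := dotp_functionall z.
    have lu := dotp_functionalr u.
    rewrite lz (functionalZ lz) (functionalB lu) !(functionalZ lu) => e.
    rewrite [dotp v z * _]mulrC -mulNr; apply: e.
    move=> y' /= [<-|y's]; first by rewrite ly (functionalZ ly) mulNr mulrC subrr.
    have ly' := dotp_functionall y'.
    by rewrite ly' (functionalZ ly') (vK y') // (uK y') // !mulr0 addr0.
  exists (c * dotp v y); first by rewrite mulf_neq0.
  by exists (c * dotp v z); rewrite -!scalerA -scalerBr.
have [|c c0 sc] := IH z; last by exists c => //; apply: span_cons.
move=> a aK; apply: zK => y' /= [<-|]; last exact: aK.
by apply/eqP; apply: contraT => ay; case: K; exists a.
Qed.

Lemma coefs_Xn_free n (v : 'I_n -> R) i :
  \sum_j v j *: coefs 'X^j = 0 -> v i = 0.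
Proof.
move=> v0; have : (\sum_j v j *: coefs 'X^j : sqn R) i = 0 by rewrite v0.
rewrite fct_sumE => e; rewrite -[RHS]e (bigD1 i) //= big1 => [|j ji].
  rewrite addr0 [RHS](_ : _ = v i * ('X^i : {poly R})`_i) //.
  by rewrite coefXn eqxx mulr1.
rewrite [LHS](_ : _ = v j * ('X^j : {poly R})`_i) //.
by rewrite coefXn eq_sym val_eqE (negbTE ji) mulr0.
Qed.

Lemma not_qspan_Xn (l : seq (sqn R)) :
  ~ forall i, qspan l (coefs 'X^i).
Proof.
by move=> /qspan_dependent [v [i /eqP vi] v0]; apply: vi; exact: coefs_Xn_free.
Qed.

(** Otherwise the annihilator of [ys] would lie in the span of [xs] over the field
    of fractions, and having finite corank it would make the space of all finitely
    supported sequences finite-dimensional. *)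
Lemma kills_pair (ys xs : seq (sqn R)) :
  exists a b, [/\ kills ys a, kills xs b & dotp a (coefs b) != 0].
Proof.
apply: contrapT => no.
have orth a : kills ys a -> qspan xs (coefs a).
  move=> ka; apply: qspan_of_kills => b kb; rewrite dotpC.
  by apply/eqP; apply: contraT => ab; case: no; exists a, b.
have [|ws wsP] := @ker_corank R {poly R} [seq dotp^~ y | y <- ys].
  by move=> f /List.in_map_iff [y [<- _]]; exact: dotp_functionall.
have lin_coefs c a b : coefs (c *: a + b) = c *: coefs a + coefs b.
  by apply/funext => i; rewrite /coefs coefD coefZ.
apply: (@not_qspan_Xn (xs ++ map coefs ws)) => i.
have [c c0 [u su uK]] := wsP 'X^i.
apply: (qspan_div c0); have -> : c *: coefs 'X^i = 1 *: coefs (c *: 'X^i - u) + coefs u.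
  rewrite -lin_coefs scale1r subrK.
  by apply/funext => j; rewrite /coefs coefZ.
apply: qspanZD.
  have /orth [d d0 sd] : kills ys (c *: 'X^i - u).
    by move=> y yys; apply: (uK (dotp^~ y)); exact: List.in_map.
  by exists d => //; exact: span_catl.
by apply: span_qspan; apply: span_catr; exact: span_map.
Qed.

(** For fixed [a] the form vanishes wherever the pairing with [a] does, so it is
    proportional to that pairing; symmetrically for fixed [b]. Comparison with a
    pair [a0], [b0] of nonzero pairing makes the factor [q / d] uniform. *)
Lemma bilin_proportional M ys xs :
    (forall a b, kills ys a -> kills xs b -> dotp a (coefs b) = 0 ->
       bilin M a b = 0) ->
  exists2 d, d != 0 & exists q, forall a b, kills ys a -> kills xs b ->
    d * bilin M a b = q * dotp a (coefs b).
Proof.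
move=> MP; have [a0 [b0 [ka0 kb0 d0]]] := kills_pair ys xs.
have dotpDr a b b' : dotp a (coefs (b + b')) = dotp a (coefs b) + dotp a (coefs b').
  by rewrite !(dotpC a) dotpDl.
have dotpZr a c b : dotp a (coefs (c *: b)) = c * dotp a (coefs b).
  by rewrite !(dotpC a) dotpZl.
have right a b b' : kills ys a -> kills xs b -> kills xs b' ->
    dotp a (coefs b') * bilin M a b = dotp a (coefs b) * bilin M a b'.
  move=> ka kb kb'; apply/eqP; rewrite -subr_eq0 -mulNr; apply/eqP.
  rewrite -!bilinZr -bilinDr; apply: MP => //.
    by rewrite -[_ *: b']addr0; apply: killsZD => //; apply: killsZD => //; exact: kills0.
  by rewrite dotpDr !dotpZr; ring.
have left a a' b : kills ys a -> kills ys a' -> kills xs b ->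
    dotp a' (coefs b) * bilin M a b = dotp a (coefs b) * bilin M a' b.
  move=> ka ka' kb; apply/eqP; rewrite -subr_eq0 -mulNr; apply/eqP.
  rewrite -!bilinZl -bilinDl; apply: MP => //.
    by rewrite -[_ *: a']addr0; apply: killsZD => //; apply: killsZD => //; exact: kills0.
  by rewrite dotpDl !dotpZl; ring.
set d := dotp a0 (coefs b0) in d0 *; exists d => //; exists (bilin M a0 b0).
have main a b : kills ys a -> kills xs b -> dotp a (coefs b0) != 0 ->
    d * bilin M a b = bilin M a0 b0 * dotp a (coefs b).
  move=> ka kb ab0; apply: (mulfI ab0).
  rewrite mulrCA (right a b b0) // mulrCA (left a a0 b0) //; ring.
move=> a b ka kb; have [ab0|] := eqVneq (dotp a (coefs b0)) 0; last exact: main.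
have := main (1 *: a + a0) b (killsZD 1 ka ka0) kb.
rewrite scale1r !dotpDl ab0 add0r bilinDl !mulrDr (main a0 b) // => e.
exact: (addIr _ (e _)).
Qed.

End Pairing.

(** * Adic convergence of pairings *)

Section Adic.
Variables (R : idomainType) (p : R).
Implicit Types (a b : {poly R}) (x y z : sqn R).

Local Notation pdvd := (pdvd p).

Lemma pdvd0 n : pdvd n 0.
Proof. by exists 0; rewrite mulr0. Qed.

Lemma pdvdD n r s : pdvd n r -> pdvd n s -> pdvd n (r + s).
Proof. by move=> [c ->] [d ->]; exists (c + d); rewrite mulrDr. Qed.

Lemma pdvdM n r s : pdvd n s -> pdvd n (r * s).
Proof. by move=> [c ->]; exists (r * c); rewrite mulrCA. Qed.

Lemma pdvdN n r : pdvd n r -> pdvd n (- r).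
Proof. by rewrite -mulN1r; exact: pdvdM. Qed.

Lemma pdvdB n r s : pdvd n r -> pdvd n s -> pdvd n (r - s).
Proof. by move=> ? ?; apply: pdvdD => //; exact: pdvdN. Qed.

Lemma pdvdBC n r s : pdvd n (r - s) -> pdvd n (s - r).
Proof. by rewrite -opprB => /pdvdN; rewrite opprK. Qed.

Lemma pdvd_trans n s r t : pdvd n (r - s) -> pdvd n (s - t) -> pdvd n (r - t).
Proof. by move=> rs st; rewrite -(subrKA s); exact: pdvdD. Qed.

Lemma pdvd_exp n r : pdvd n (p ^+ n * r).
Proof. by exists r. Qed.

Lemma pdvdW n m r : (m <= n)%N -> pdvd n r -> pdvd m r.
Proof.
by move=> mn [c ->]; exists (p ^+ (n - m) * c); rewrite mulrA -exprD subnKC.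
Qed.

Lemma pdvd_sum n N (F : nat -> R) :
  (forall i, (i < N)%N -> pdvd n (F i)) -> pdvd n (\sum_(i < N) F i).
Proof.
elim: N => [|N IH] FN; first by rewrite big_ord0; exact: pdvd0.
rewrite big_ord_recr; apply: pdvdD; last exact: FN.
by apply: IH => i iN; apply: FN; rewrite ltnS ltnW.
Qed.

Definition nullseq x := forall n, exists N, forall i, (N <= i)%N -> pdvd n (x i).

Definition approx n x a := forall i, pdvd n (x i - a`_i).

(** A series that converges only in the completion of [R] counts as divergent. *)
Definition pairs_to x y (r : R) := forall n, exists N, forall m, (N <= m)%N ->
  pdvd n (\sum_(i < m) (x i : R) * y i - r).

(** Orthogonality modulo [R]: the pairing takes a value in [R]. *)
Definition orth x y := exists r, pairs_to x y r.

Lemma approx_coefs n a : approx n (coefs a) a.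
Proof. by move=> i; rewrite /coefs subrr; exact: pdvd0. Qed.

Lemma approxW n m x a : (m <= n)%N -> approx n x a -> approx m x a.
Proof. by move=> mn xa i; exact: pdvdW (xa i). Qed.

Lemma approx_trunc x n N :
  (forall i, (N <= i)%N -> pdvd n (x i)) -> approx n x (\poly_(i < N) x i).
Proof.
move=> xN i; rewrite coef_poly; case: ltnP => [_|/xN]; last by rewrite subr0.
by rewrite subrr; exact: pdvd0.
Qed.

Lemma nullseq_approx x : nullseq x <-> forall n, exists a, approx n x a.
Proof.
split=> xD n; have [N xN] := xD n; last first.
  exists (size N) => i /(nth_default 0) Ni; have := xN i.
  by rewrite Ni subr0.
by exists (\poly_(i < N) x i); exact: approx_trunc.
Qed.

Lemma nullseq_coefs a : nullseq (coefs a).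
Proof. by apply/nullseq_approx => n; exists a; exact: approx_coefs. Qed.

Lemma nullseqZD c x y : nullseq x -> nullseq y -> nullseq (c *: x + y).
Proof.
move=> xD yD n; have [[N xN] [N' yN]] := (xD n, yD n); exists (maxn N N') => i.
rewrite geq_max => /andP [Ni N'i]; apply: pdvdD (yN _ N'i).
exact: (pdvdM c (xN _ Ni)).
Qed.

Lemma approx_sum n x a y m : approx n x a -> (size a <= m)%N ->
  pdvd n (\sum_(i < m) (x i : R) * y i - dotp a y).
Proof.
move=> xa am; rewrite (dotpE _ am) -sumrB.
apply: (@pdvd_sum n m (fun i => (x i : R) * y i - a`_i * y i)) => i _.
by rewrite -mulrBl mulrC; exact: pdvdM.
Qed.

Lemma pairs_to_approx x y r n a :
  pairs_to x y r -> approx n x a -> pdvd n (dotp a y - r).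
Proof.
move=> xyr xa; have [N NP] := xyr n.
apply: (pdvd_trans _ (NP _ (leq_maxl N (size a)))).
by apply: pdvdBC; apply: approx_sum; rewrite ?leq_maxr.
Qed.

Lemma pairs_toP x y r :
  (forall n, exists2 a, approx n x a & pdvd n (dotp a y - r)) -> pairs_to x y r.
Proof.
move=> xyr n; have [a xa ar] := xyr n; exists (size a) => m am.
by apply: pdvd_trans ar; exact: approx_sum.
Qed.

Lemma pairs_to_coefs a y : pairs_to (coefs a) y (dotp a y).
Proof.
apply: pairs_toP => n; exists a; first exact: approx_coefs.
by rewrite subrr; exact: pdvd0.
Qed.

Lemma pairs_toC x y r : pairs_to x y r -> pairs_to y x r.
Proof.
move=> xyr n; have [N NP] := xyr n; exists N => m /NP.
by congr (pdvd _ (_ - _)); apply: eq_bigr => i _; rewrite mulrC.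
Qed.

Lemma orthC x y : orth x y -> orth y x.
Proof. by move=> [r /pairs_toC]; exists r. Qed.

Lemma orth_coefs a y : orth (coefs a) y.
Proof. by exists (dotp a y); exact: pairs_to_coefs. Qed.

Lemma pairs_toZD c x x' y r r' : pairs_to x y r -> pairs_to x' y r' ->
  pairs_to (c *: x + x') y (c * r + r').
Proof.
move=> xy xy' n; have [[N NP] [N' NP']] := (xy n, xy' n); exists (maxn N N') => m.
rewrite geq_max => /andP [/NP Nm /NP' N'm].
rewrite (_ : _ - _ = c * (\sum_(i < m) (x i : R) * y i - r) +
  (\sum_(i < m) (x' i : R) * y i - r')).
  by apply: pdvdD => //; exact: pdvdM.
rewrite mulrBr mulr_sumr opprD addrACA -big_split; congr (_ + _).
apply: eq_bigr => i _.
by rewrite [LHS](_ : _ = (c * x i + x' i) * y i) // mulrDl mulrA.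
Qed.

Lemma pairs_toZ c x y r : pairs_to x y r -> pairs_to (c *: x) y (c * r).
Proof.
move=> xyr; rewrite -[_ *: _]addr0 -[c * r]addr0; apply: pairs_toZD => // n.
exists 0 => m _; rewrite subr0 big1 => [|i _]; first exact: pdvd0.
by rewrite mul0r.
Qed.

Lemma pairs_to_span ys x z :
    (forall y, List.In y ys -> pairs_to x y 0) -> span ys z -> pairs_to x z 0.
Proof.
elim: ys z => [|y ys IH] z ysP /=.
  move=> -> n; exists 0 => m _; rewrite subr0 big1 => [|i _]; first exact: pdvd0.
  by rewrite mulr0.
move=> [k sz]; rewrite -(subrK (k *: y) z) addrC (_ : 0 = k * 0 + 0 :> R).
  apply: pairs_toC; apply: pairs_toZD; first by apply/pairs_toC/ysP; left.
  by apply: pairs_toC; apply: IH => // y' y's; apply: ysP; right.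
by rewrite mulr0 addr0.
Qed.

Definition perp (Z : set (sqn R)) : set (sqn R) :=
  [set x | forall z, Z z -> orth x z].

Lemma perp_coefs Z a : perp Z (coefs a).
Proof. by move=> z _; exact: orth_coefs. Qed.

Lemma perpZD Z c x y : perp Z x -> perp Z y -> perp Z (c *: x + y).
Proof.
move=> xZ yZ z Zz; have [[r xr] [s ys]] := (xZ z Zz, yZ z Zz).
by exists (c * r + s); exact: pairs_toZD.
Qed.

Lemma sub_perp_perp Z : Z `<=` perp (perp Z).
Proof. by move=> z Zz x /(_ z Zz)/orthC. Qed.

Lemma perpS Z Z' : Z `<=` Z' -> perp Z' `<=` perp Z.
Proof. by move=> ZZ' x xZ' z /ZZ'/xZ'. Qed.

Hypothesis p0 : p != 0.

(** If [p ^ n * x] pairs with [z] to [r], then the partial sums, being divisible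
    by [p ^ n], force [p ^ n] to divide [r]. *)
Lemma perp_pure Z n x : perp Z (p ^+ n *: x) -> perp Z x.
Proof.
move=> xZ z Zz; have [r xr] := xZ z Zz.
have pn0 : p ^+ n != 0 by rewrite expf_neq0.
have e m : \sum_(i < m) ((p ^+ n *: x) i : R) * z i =
    p ^+ n * \sum_(i < m) (x i : R) * z i.
  by rewrite mulr_sumr; apply: eq_bigr => i _; rewrite mulrA.
have [N NP] := xr n; have [s rs] : pdvd n r.
  have := NP _ (leqnn N); rewrite e => /pdvdN; rewrite opprB => h.
  rewrite -(subrK (p ^+ n * \sum_(i < N) (x i : R) * z i) r).
  by apply: pdvdD => //; exact: pdvd_exp.
exists s => m; have [M MP] := xr (n + m)%N; exists M => k /MP [c].
rewrite e rs -mulrBr exprD -mulrA => /(mulfI pn0) ->.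
exact: pdvd_exp.
Qed.

Hypothesis p_sep : forall r, (forall n, pdvd n r) -> r = 0.

Lemma pairs_to_uniq x y r s : pairs_to x y r -> pairs_to x y s -> r = s.
Proof.
move=> xr xs; apply/eqP; rewrite -subr_eq0; apply/eqP/p_sep => n.
have [[N NP] [N' NP']] := (xr n, xs n).
apply: pdvd_trans (NP' _ (leq_maxr N N')).
by apply: pdvdBC; apply: NP; exact: leq_maxl.
Qed.

Hypothesis p_cancel : forall c, c != 0 ->
  exists k, forall n r, pdvd (n + k) (c * r) -> pdvd n r.

Lemma nullseq_div c x : c != 0 -> nullseq (c *: x) -> nullseq x.
Proof.
move=> /p_cancel [k kP] xD n; have [N NP] := xD (n + k)%N.
by exists N => i /NP; exact: kP.
Qed.

Lemma nullseq_span ys z :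
  (forall y, List.In y ys -> nullseq y) -> span ys z -> nullseq z.
Proof.
elim: ys z => [|y ys IH] z ysD /=.
  by move=> -> n; exists 0 => i _; exact: pdvd0.
move=> [k /IH zD]; rewrite -(subrK (k *: y) z) addrC; apply: nullseqZD.
  by apply: ysD; left.
by apply: zD => y' y's; apply: ysD; right.
Qed.

Lemma nullseq_qspan ys z :
  (forall y, List.In y ys -> nullseq y) -> qspan ys z -> nullseq z.
Proof. by move=> ysD [c c0 /(nullseq_span ysD)]; exact: nullseq_div. Qed.

End Adic.

(** * Generic pairs of sequences *)

Section Generic.
Variables (R : idomainType) (p : R).
Implicit Types (a b : {poly R}).

Local Notation pdvd := (pdvd p).
Local Notation approx := (approx p).
Local Notation orth := (orth p).
Local Notation nullseq := (nullseq p).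

(** [r] is the value at [g], [h] of the [p]-adically continuous extension of the
    bilinear form of [M]. *)
Definition bil_to (M : nat -> sqn R) (g h : sqn R) (r : R) := forall n a b,
  approx n g a -> approx n h b -> pdvd n (bilin M a b - r).

(** A correction that kills this list changes neither the pairings with the first
    [n] members of [y] nor the first [n] coordinates. *)
Definition frozen (y : nat -> sqn R) n : seq (sqn R) :=
  mkseq y n ++ mkseq (fun i => coefs 'X^i) n.

Lemma In_mkseq T (f : nat -> T) n u :
  List.In u (mkseq f n) <-> exists2 i, (i < n)%N & u = f i.
Proof.
elim: n => [|n IH]; first by split=> [|[]].
rewrite /mkseq -addn1 iotaD map_cat List.in_app_iff -/(mkseq f n) IH /= add0n addn1.
split=> [[[i i_n ->]|[<-|//]]|[i]].
- by exists i => //; exact: leqW.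
- by exists n.
- rewrite ltnS leq_eqVlt => /orP [/eqP -> ->|i_n ->]; first by right; left.
  by left; exists i.
Qed.

Lemma kills_frozen y n a : kills (frozen y n) a <->
  forall i, (i < n)%N -> dotp a (y i) = 0 /\ a`_i = 0.
Proof.
rewrite /frozen kills_cat; split=> [[k k'] i i_n|k].
  split; first by apply: k; apply/In_mkseq; exists i.
  by rewrite -[LHS](dotpXn i (coefs a)) dotpC; apply: k'; apply/In_mkseq; exists i.
split=> z /In_mkseq [i i_n ->]; first by have [] := k i i_n.
by rewrite dotpC dotpXn; have [] := k i i_n.
Qed.

Lemma poly_limit (y : nat -> sqn R) (G : nat -> {poly R}) (N : nat -> nat) :
    (forall n, n <= N n)%N -> (forall n, N n <= N n.+1)%N ->
    (forall n, exists2 a, kills (frozen y n) a & G n.+1 = G n + p ^+ N n *: a) ->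
  exists2 g, forall n, approx (N n) g (G n) & forall j, orth g (y j).
Proof.
move=> leN Nmono GS.
have Gle k l : (k <= l)%N ->
    exists2 a, kills (frozen y k) a & G l = G k + p ^+ N k *: a.
  move=> /subnKC <-; elim: (l - k)%N => [|d [a ka Ga]].
    by exists 0; [exact: kills0|rewrite addn0 scaler0 addr0].
  have [b kb Gb] := GS (k + d)%N.
  have Nd : (N k <= N (k + d))%N.
    by elim: (d) => [|d' IH]; rewrite ?addn0 // addnS (leq_trans IH).
  exists (p ^+ (N (k + d) - N k) *: b + a); last first.
    rewrite addnS Gb Ga scalerDr scalerA -exprD subnKC //.
    by rewrite -addrA; congr (_ + _); rewrite addrC.
  apply: killsZD => //; apply/kills_frozen => i ik.
  by move/kills_frozen: kb; apply; exact: ltn_addr.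
(* Coordinate [i] is constant from index [i.+1] on. *)
pose g : sqn R := fun i => (G i.+1)`_i.
have gG n : approx (N n) g (G n).
  move=> i; rewrite /g; case: (ltnP i n) => [i_n|n_i].
    have [a /kills_frozen ka ->] := Gle _ _ i_n.
    have [_ ai] := ka i (leqnn _).
    by rewrite coefD coefZ ai mulr0 addr0 subrr; exact: pdvd0.
  have [a _ ->] := Gle _ _ (leqW n_i).
  by rewrite coefD coefZ addrAC subrr add0r; exact: pdvd_exp.
exists g => // j; exists (dotp (G j.+1) (y j)); apply: pairs_toP => n.
exists (G (maxn n j.+1)).
  by apply: approxW (gG _); apply: leq_trans (leN _); exact: leq_maxl.
have [a /kills_frozen /(_ j (leqnn _)) [aj _] ->] := Gle _ _ (leq_maxr n j.+1).
by rewrite dotpDl dotpZl aj mulr0 addr0 subrr; exact: pdvd0.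
Qed.

Hypothesis p_sep : forall r, (forall n, pdvd n r) -> r = 0.
Variable rs : nat -> R.
Hypothesis rsP : forall r, exists n, rs n = r.

(** Both sequences are sums of finitely supported corrections divisible by
    growing powers of [p]. From step [n] on, the corrections leave the first
    [n] coordinates and the first [n] pairings alone, so coordinates and
    pairings converge in [R]; the value of the bilinear form is moved away from
    [rs n] at step [n] and is kept away by the modulus chosen for later
    corrections. *)
Lemma generic_pair (y x : nat -> sqn R) (M : nat -> sqn R)
    (Inv : {poly R} -> {poly R} -> Prop) g0 h0 :
    Inv g0 h0 ->
    (forall n N r g h, Inv g h -> exists a b,
      [/\ kills (frozen y n) a, kills (frozen x n) b,
          Inv (g + p ^+ N *: a) (h + p ^+ N *: b) &
          bilin M (g + p ^+ N *: a) (h + p ^+ N *: b) <> r]) ->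
  exists g h, [/\ nullseq g, nullseq h,
    (forall j, orth g (y j)) /\ (forall j, orth h (x j)),
    forall n, exists a b, [/\ Inv a b, approx n g a & approx n h b] &
    ~ exists r, bil_to M g h r].
Proof.
move=> Inv0 dense; pose S := ({poly R} * {poly R} * nat)%type.
pose good (s : S) := Inv s.1.1 s.1.2.
pose step n (s s' : S) := [/\ good s', (s.2 < s'.2)%N,
  exists2 a, kills (frozen y n) a & s'.1.1 = s.1.1 + p ^+ s.2 *: a,
  exists2 b, kills (frozen x n) b & s'.1.2 = s.1.2 + p ^+ s.2 *: b &
  ~ pdvd s'.2 (bilin M s'.1.1 s'.1.2 - rs n)].
have /choice [next nextP] (ns : nat * S) :
    exists s', good ns.2 -> step ns.1 ns.2 s'.
  case: ns => n [[g h] N] /=; have [Igh|nI] := pselect (Inv g h); last first.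
    by exists (g, h, N) => /nI.
  have [a [b [ka kb I' ne]]] := dense n N (rs n) g h Igh.
  have [m mP] : exists m, ~ pdvd m
      (bilin M (g + p ^+ N *: a) (h + p ^+ N *: b) - rs n).
    apply/existsNP => all; apply: ne; apply/eqP; rewrite -subr_eq0.
    exact/eqP/p_sep.
  exists (g + p ^+ N *: a, h + p ^+ N *: b, (N + m).+1); split=> //=.
  - by rewrite ltnS leq_addr.
  - by exists a.
  - by exists b.
  - by move=> /(pdvdW (leqW (leq_addl N m))).
pose s := fix s n : S := if n is k.+1 then next (k, s k) else (g0, h0, 0%N).
have sI n : good (s n) by elim: n => //= n /(nextP (n, _)) [].
have sP n : step n (s n) (s n.+1) by exact: (nextP (n, s n) (sI n)).
have Nlt n : ((s n).2 < (s n.+1).2)%N by have [] := sP n.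
have Nge n : (n <= (s n).2)%N by elim: n => // n IH; exact: leq_ltn_trans (Nlt n).
have [g gs gy] : exists2 g, forall n, approx (s n).2 g (s n).1.1 &
    forall j, orth g (y j).
  apply: (@poly_limit y (fun n => (s n).1.1) (fun n => (s n).2)) => // n.
    exact: ltnW.
  by have [] := sP n.
have [h hs hx] : exists2 h, forall n, approx (s n).2 h (s n).1.2 &
    forall j, orth h (x j).
  apply: (@poly_limit x (fun n => (s n).1.2) (fun n => (s n).2)) => // n.
    exact: ltnW.
  by have [] := sP n.
have ap n : exists a b, [/\ Inv a b, approx n g a & approx n h b].
  exists (s n).1.1, (s n).1.2; split; [exact: sI| |];
    by [apply: approxW (gs n)|apply: approxW (hs n)].
exists g, h; split=> //.
- by apply/nullseq_approx => n; have [a [b []]] := ap n; exists a.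
- by apply/nullseq_approx => n; have [a [b []]] := ap n; exists b.
move=> [r ghr]; have [n nr] := rsP r; have [_ _ _ _ []] := sP n.
by rewrite nr; exact: ghr.
Qed.

End Generic.

(** * Excluding a sequence or a matrix *)

Section Killing.
Variables (R : idomainType) (p : R).
Implicit Types (a b : {poly R}) (X Y : set (sqn R)).

Local Notation pdvd := (pdvd p).
Local Notation orth := (orth p).
Local Notation nullseq := (nullseq p).
Local Notation bil_to := (bil_to p).
Local Notation perp := (perp p).

Hypothesis p0 : p != 0.
Hypothesis p_sep : forall r, (forall n, pdvd n r) -> r = 0.
Hypothesis p_cancel : forall c, c != 0 ->
  exists k, forall n r, pdvd (n + k) (c * r) -> pdvd n r.
Hypothesis R_countable : countable [set: R].

Lemma enumeration T (Y : set T) t : countable Y ->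
  exists y : nat -> T, (forall z, Y z -> exists n, y n = z) /\
    forall n, Y (y n) \/ y n = t.
Proof.
move=> /countable_injP [f fI].
have /choice [y yP] n : exists u, (forall z, Y z -> f z = n -> u = z) /\ (Y u \/ u = t).
  have [[z [Yz fz]]|no] := pselect (exists z, Y z /\ f z = n).
    exists z; split; last by left.
    by move=> z' Yz' fz'; apply: fI; rewrite ?inE // fz fz'.
  by exists t; split; [move=> z Yz fz; case: no; exists z|right].
exists y; split=> [z Yz|n]; last by have [] := yP n.
by exists (f z); apply: (yP (f z)).1.
Qed.

Let rs_ex : exists rs : nat -> R, forall r, exists n, rs n = r.
Proof. by have [rs [rsP _]] := enumeration 0 R_countable; exists rs => r; exact: rsP. Qed.

Lemma frozen_mem Y y n z : (forall i, Y (y i) \/ y i = 0) ->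
  List.In z (frozen y n) -> Y z \/ exists a, z = coefs a.
Proof.
move=> yY z_in; case: (List.in_app_or _ _ _ z_in) => /In_mkseq [i _ ->].
  by have [|->] := yY i; [left|right; exists 0; apply/funext => j; rewrite /coefs coef0].
by right; exists 'X^i.
Qed.

(** The second difference of a function that is constant on the four corners. *)
Lemma bilin_frozen M g h q r a b : q != 0 ->
    bilin M (g + q *: a) (h + q *: b) = r -> bilin M (g + q *: a) (h + q *: 0) = r ->
    bilin M (g + q *: 0) (h + q *: b) = r -> bilin M (g + q *: 0) (h + q *: 0) = r ->
  bilin M a b = 0.
Proof.
move=> q0; rewrite !scaler0 !addr0 !bilinDl !bilinDr !bilinZl !bilinZr => e1 e2 e3 e4.
have: q * (q * bilin M a b) = r - r - r + r by rewrite -{1}e1 -{1}e2 -{1}e3 -e4; ring.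
by rewrite subrr sub0r addNr => /eqP; rewrite !mulf_eq0 (negbTE q0) => /eqP.
Qed.

(** A finitely supported correction that pairs nontrivially with [w] and kills
    finitely many members of [Y] always exists; otherwise [w] would depend on null
    sequences over the field of fractions, and so be null itself. *)
Lemma kill_sequence Y w : countable Y -> Y `<=` nullseq -> ~ nullseq w ->
  exists g, [/\ nullseq g, perp Y g & ~ orth g w].
Proof.
move=> cY YD wD; have [rs rsP] := rs_ex.
have [y [yP yY]] := enumeration (0 : sqn R) cY.
(* With the second argument fixed to the unit vector [1], the form of [M] is the
   pairing with [w]. *)
pose M : nat -> sqn R := fun i j => if j is 0 then w i else 0.
have Mw a b : bilin M a b = b`_0 * dotp a w.
  rewrite -(functionalZ (dotp_functionalr a)); congr dotp; apply/funext => i.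
  rewrite (dotpE _ (leqnSn (size b))) big_ord_recl big1 ?addr0 // => j _.
  by rewrite mulr0.
have M1 a : bilin M a 1 = dotp a w by rewrite Mw coef1 mul1r.
have [n N r g h ->|g [h [gD _ [gy _] _ no]]] :=
    @generic_pair R p p_sep rs rsP y (fun=> 0) M (fun _ h => h = 1) 0 1 erefl.
- have k0 : kills (frozen (fun=> 0 : sqn R) n) 0 by exact: kills0.
  have s0 : 1 + p ^+ N *: 0 = 1 :> {poly R} by rewrite scaler0 addr0.
  have [gr|gr] := pselect (dotp g w = r); last first.
    by exists 0, 0; split=> //; [exact: kills0|rewrite s0 M1 scaler0 addr0].
  have [a ka aw] : exists2 a, kills (frozen y n) a & dotp a w != 0.
    apply: contrapT => no; apply: wD; apply: (nullseq_qspan p_cancel (ys := frozen y n)).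
      move=> z /(frozen_mem yY) [/YD //|[b ->]]; exact: nullseq_coefs.
    apply: qspan_of_kills => a ka; apply/eqP; apply: contraT => aw.
    by case: no; exists a.
  exists a, 0; split=> //; rewrite s0 M1 dotpDl dotpZl gr => /eqP.
  rewrite -subr_eq0 addrAC subrr add0r mulf_eq0 (negbTE aw) orbF.
  by rewrite expf_eq0 (negbTE p0) andbF.
exists g; split=> //; first by move=> z /yP [n <-].
move=> [r gw]; apply: no; exists (r * h 0%N) => n a b ga hb.
rewrite Mw (_ : _ - _ = b`_0 * (dotp a w - r) - r * (h 0%N - b`_0)); last first.
  by rewrite [h 0%N]lock; ring.
by apply: pdvdB; apply: pdvdM; [exact: pairs_to_approx gw ga|exact: hb].
Qed.

(** The case of the identity matrix; it always succeeds by [kills_pair]. *)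
Lemma new_pair X Y : countable X -> countable Y ->
  exists g h, [/\ nullseq g /\ nullseq h, perp Y g, perp X h & ~ orth g h].
Proof.
move=> cX cY; have [rs rsP] := rs_ex.
have [y [yP yY]] := enumeration (0 : sqn R) cY.
have [x [xP xX]] := enumeration (0 : sqn R) cX.
pose M : nat -> sqn R := fun i => coefs 'X^i.
have Mab a b : bilin M a b = dotp a (coefs b).
  by congr dotp; apply/funext => i; rewrite dotpC dotpXn.
have [n N r g h _|g [h [gD hD [gy hx] _ no]]] :=
    @generic_pair R p p_sep rs rsP y x M (fun _ _ => True) 0 0 I.
  apply: contrapT => no.
  have [a [b [ka kb]]] := kills_pair (frozen y n) (frozen x n); case/eqP.
  have eqr a' b' : kills (frozen y n) a' -> kills (frozen x n) b' ->
      bilin M (g + p ^+ N *: a') (h + p ^+ N *: b') = r.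
    by move=> ka' kb'; apply: contrapT => ne; apply: no; exists a', b'.
  rewrite -Mab; apply: (@bilin_frozen M g h (p ^+ N) r); rewrite ?expf_neq0 //.
  - exact: eqr.
  - by apply: eqr => //; exact: kills0.
  - by apply: eqr => //; exact: kills0.
  - by apply: eqr; exact: kills0.
exists g, h; split=> //; [by move=> z /yP [n <-]|by move=> z /xP [n <-]|].
move=> [r ghr]; apply: no; exists r => n a b ga hb; rewrite Mab.
have e : pdvd n (dotp a h - r) := pairs_to_approx ghr ga.
apply: pdvd_trans e; rewrite -(functionalB (dotp_functionalr a)).
apply: (@pdvd_sum _ p n _ (fun i => a`_i * (coefs b - h) i)) => i _.
by apply: pdvdM; apply: pdvdBC; exact: hb.
Qed.

(** If at some stage of the construction of a pair [g], [h] with zero pairing the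
    value of the form cannot be changed by any admissible correction, then the
    form vanishes on all admissible corrections that are orthogonal to each
    other. *)
Lemma kill_matrix X Y M : countable X -> countable Y ->
    (exists g h, [/\ nullseq g /\ nullseq h, perp Y g, perp X h, orth g h &
       ~ exists r, bil_to M g h r]) \/
  exists ys xs, (forall y, List.In y ys -> Y y \/ exists a, y = coefs (a : {poly R})) /\
    (forall a b : {poly R}, kills ys a -> kills xs b -> dotp a (coefs b) = 0 ->
      bilin M a b = 0).
Proof.
move=> cX cY; have [rs rsP] := rs_ex.
have [y [yP yY]] := enumeration (0 : sqn R) cY.
have [x [xP xX]] := enumeration (0 : sqn R) cX.
have [dense|] := pselect (forall n N r (g h : {poly R}),
  dotp g (coefs h) = 0 -> exists a b,
  [/\ kills (frozen y n) a, kills (frozen x n) b,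
      dotp (g + p ^+ N *: a) (coefs (h + p ^+ N *: b)) = 0 &
      bilin M (g + p ^+ N *: a) (h + p ^+ N *: b) <> r]).
  left; have [|g [h [gD hD [gy hx] gh no]]] :=
    @generic_pair R p p_sep rs rsP y x M
      (fun g h : {poly R} => dotp g (coefs h) = 0) 0 0 _ dense.
    by exact: (functional0 (dotp_functionall _)).
  exists g, h; split=> //; [by move=> z /yP [n <-]|by move=> z /xP [n <-]|].
  exists 0; apply: pairs_toP => n; have [a [b [ab ga hb]]] := gh n.
  exists a => //; rewrite subr0 -[dotp a h]subr0 -ab -(functionalB (dotp_functionalr a)).
  apply: (@pdvd_sum _ p n _ (fun i => a`_i * (h - coefs b) i)) => i _.
  by apply: pdvdM; exact: hb.
move=> /existsNP [n /existsNP [N /existsNP [r /existsNP [g /existsNP [h]]]]].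
move=> /not_implyP [gh no]; right.
exists (coefs h :: frozen y n), (coefs g :: frozen x n); split.
  by move=> z /= [<-|/(frozen_mem yY) //]; right; exists h.
move=> a b ka kb ab.
have eqr a' b' : kills (coefs h :: frozen y n) a' -> kills (coefs g :: frozen x n) b' ->
    dotp a' (coefs b') = 0 -> bilin M (g + p ^+ N *: a') (h + p ^+ N *: b') = r.
  move=> ka' kb' ab'; apply: contrapT => ne; apply: no; exists a', b'; split=> //.
  - by move=> z z_in; apply: ka'; right.
  - by move=> z z_in; apply: kb'; right.
  have a'h : dotp a' (coefs h) = 0 by apply: ka'; left.
  have b'g : dotp b' (coefs g) = 0 by apply: kb'; left.
  rewrite dotpDl dotpZl (dotpC g) (dotpC a') !dotpDl !dotpZl.
  by rewrite b'g (dotpC h) (dotpC h a') (dotpC b') gh a'h ab' !(mulr0, addr0).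
have k0 zs : kills zs (0 : {poly R}) by exact: kills0.
have d0 : dotp 0 (coefs b) = 0 by exact: (functional0 (dotp_functionall _)).
have d0' : dotp a (coefs 0) = 0.
  by rewrite dotpC; exact: (functional0 (dotp_functionall _)).
apply: (@bilin_frozen M g h (p ^+ N) r); rewrite ?expf_neq0 //; apply: eqr => //.
exact: (functional0 (dotp_functionall _)).
Qed.

End Killing.

(** * Reflexive perpendiculars *)

Section PerpModule.
Variables (R : idomainType) (p : R) (Z : set (sqn R)).

Definition perp_pred : {pred sqn R} := [pred x | `[< perp p Z x >]].

Lemma perp_pred_closed : GRing.submod_closed perp_pred.
Proof.
split; first by apply/asboolP => z _; exists 0; apply: pairs_toP => n; exists 0;
  [move=> i; rewrite coef0 subrr|rewrite (functional0 (dotp_functionall _)) subrr];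
  exact: pdvd0.
by move=> a x y /asboolP xZ /asboolP yZ; apply/asboolP; exact: perpZD.
Qed.

Record perp_module := PerpModule {
  perp_val : sqn R;
  perp_valP : perp_val \in perp_pred }.

HB.instance Definition _ := [isSub for perp_val].
HB.instance Definition _ := [Choice of perp_module by <:].
HB.instance Definition _ :=
  GRing.SubChoice_isSubLmodule.Build R (sqn R) perp_pred perp_module perp_pred_closed.

Definition to_perp x (xZ : perp p Z x) : perp_module := PerpModule (asboolT xZ).

Lemma perp_valK (x : perp_module) : perp p Z (perp_val x).
Proof. exact/asboolP/perp_valP. Qed.

End PerpModule.

Lemma poly_functional (R : idomainType) (g : {poly R} -> R) a :
  functional g -> g a = dotp a (fun i => g 'X^i).
Proof.
move=> lg; rewrite -{1}[a]coefK poly_def.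
rewrite (functional_sum lg (size a) (fun i => a`_i *: 'X^i)).
by apply: eq_bigr => i _; rewrite (functionalZ lg).
Qed.

Lemma dual_of_functional (R : idomainType) (V : lmodType R) (f : V -> R) :
  functional f -> exists phi : dual V, forall x, phi x = f x.
Proof.
move=> lf; pose F : V -> R^o := f.
have Flin : linear F by [].
by exists (HB.pack_for (dual V) F (GRing.isLinear.Build _ _ _ _ F Flin)).
Qed.

Lemma dual_functional (R : idomainType) (V : lmodType R) (phi : dual V) :
  functional (phi : V -> R).
Proof. by move=> a x y; rewrite linearP. Qed.

Section Reflexivity.
Variables (R : idomainType) (p : R).
Hypothesis p0 : p != 0.
Hypothesis p_sep : forall r, (forall n, pdvd p n r) -> r = 0.

Local Notation perp := (perp p).
Local Notation perp_module := (perp_module p).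

Definition finite_vec Z a : perp_module Z := to_perp (@perp_coefs R p Z a).

Lemma finite_vecZD Z c a b :
  finite_vec Z (c *: a + b) = c *: finite_vec Z a + finite_vec Z b.
Proof.
by apply: val_inj; apply/funext => i; rewrite /= /coefs coefD coefZ.
Qed.

(** The error of the approximation is [p ^ n] times an element of the module, by
    [perp_pure]; so functionals are [p]-adically continuous. *)
Lemma functional_approx Z (f : perp_module Z -> R) s n a :
    functional f -> approx p n (perp_val s) a ->
  pdvd p n (f s - dotp a (fun i => f (finite_vec Z 'X^i))).
Proof.
move=> lf /choice [c sa].
have lfv : functional (f \o finite_vec Z) by move=> k b b'; rewrite /= finite_vecZD lf.
rewrite -(poly_functional a lfv) /= -(functionalB lf).
have e : p ^+ n *: (c : sqn R) = perp_val s - coefs a.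
  by apply/funext => i; rewrite [RHS]sa.
have cZ : perp Z c.
  apply: (perp_pure p0 (n := n)); rewrite e -scaleN1r addrC; apply: perpZD.
    exact: perp_coefs.
  exact: perp_valK.
have -> : s - finite_vec Z a = p ^+ n *: to_perp cZ by apply: val_inj; rewrite /= e.
by rewrite (functionalZ lf); exact: pdvd_exp.
Qed.

Lemma functional_pairs Z (f : perp_module Z -> R) s :
    perp Z `<=` nullseq p -> functional f ->
  pairs_to p (perp_val s) (fun i => f (finite_vec Z 'X^i)) (f s).
Proof.
move=> ZD lf; apply: pairs_toP => n.
have [a sa] := (nullseq_approx p (perp_val s)).1 (ZD _ (perp_valK s)) n.
by exists a => //; apply: pdvdBC; exact: functional_approx.
Qed.

Lemma pairing_functional Z h : perp (perp Z) h ->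
  exists2 f : perp_module Z -> R, functional f &
    forall g, pairs_to p (perp_val g) h (f g).
Proof.
move=> hZ; have /choice [f fP] (g : perp_module Z) :
    exists r, pairs_to p (perp_val g) h r.
  by apply: orthC; apply: hZ; exact: perp_valK.
exists f => // a x y; apply: (pairs_to_uniq p_sep (fP _)).
by apply: pairs_toZD; exact: fP.
Qed.

(** By continuity the dual of [perp Z] is [perp (perp Z)], and the dual of the
    latter is [perp Z] again. *)
Theorem perp_reflexive Z :
    perp Z `<=` nullseq p -> perp (perp Z) `<=` nullseq p ->
  reflexive_module (perp_module Z).
Proof.
move=> ZD ZZD; have sigma_inj : injective (sigma (G := perp_module Z)).
  move=> x y xy; apply: val_inj; apply/funext => i.
  have li : functional (fun z : perp_module Z => perp_val z i) by [].
  have [phi phiP] := dual_of_functional li.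
  by have := congr1 (fun s : dual (dual _) => s phi) xy; rewrite /= /eval_at !phiP.
suff /choice [g gP] : forall Psi, exists x, sigma x = Psi :> dual (dual (perp_module Z)).
  by exists g => // x; apply: sigma_inj.
move=> Psi.
have /choice [ev evP] (h : perp_module (perp Z)) : exists phi : dual (perp_module Z),
    forall g, pairs_to p (perp_val g) (perp_val h) (phi g).
  have [f lf fP] := pairing_functional (perp_valK h).
  have [phi phiP] := dual_of_functional lf.
  by exists phi => g; rewrite phiP.
pose F h : R := Psi (ev h).
have lF : functional F.
  move=> a h h'; rewrite -dual_functional; congr (Psi _).
  apply: dual_ext => g; apply: (pairs_to_uniq p_sep (evP _ g)).
  by apply: pairs_toC; apply: pairs_toZD; apply: pairs_toC; exact: evP.
pose x : sqn R := fun i => F (finite_vec (perp Z) 'X^i).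
have xF h : pairs_to p (perp_val h) x (F h) by exact: functional_pairs.
have xZ : perp Z x.
  move=> z Zz; apply: orthC; have zZ : perp (perp Z) z by exact: sub_perp_perp.
  by exists (F (to_perp zZ)); exact: (xF (to_perp zZ)).
exists (to_perp xZ); apply: dual_ext => f /=; rewrite /eval_at.
have fP s := functional_pairs s ZD (dual_functional f).
have hZ : perp (perp Z) (fun i => f (finite_vec Z 'X^i)).
  move=> s sZ; apply: orthC; exists (f (to_perp sZ)); exact: (fP (to_perp sZ)).
have -> : f = ev (to_perp hZ).
  apply: dual_ext => g; apply: (pairs_to_uniq p_sep (fP g)).
  exact: (evP (to_perp hZ) g).
apply: (pairs_to_uniq p_sep (evP (to_perp hZ) (to_perp xZ))).
by apply: pairs_toC; exact: xF.
Qed.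

End Reflexivity.

(** * Endomorphisms of finite rank up to a scalar *)

Section FiniteRank.
Variables (R : idomainType) (p : R).
Hypothesis p0 : p != 0.
Hypothesis p_sep : forall r, (forall n, pdvd p n r) -> r = 0.
Variable Z : set (sqn R).
Hypothesis ZD : perp p Z `<=` nullseq p.

Local Notation V := (perp_module p Z).
Local Notation unitv i := (finite_vec p Z 'X^i).

Variable phi : {linear V -> V}.
Let M i : sqn R := perp_val (phi (unitv i)).

Lemma bilin_endo (a b : {poly R}) :
  dotp b (perp_val (phi (finite_vec p Z a))) = bilin M a b.
Proof.
apply: (@poly_functional _ (fun a => dotp b (perp_val (phi (finite_vec p Z a))))).
by move=> c a' b'; rewrite finite_vecZD linearP -(dotp_functionalr b).
Qed.

(** By continuity the value is the pairing of [phi g] with [h]. *)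
Lemma endo_bil_to (g : V) h : perp p (perp p Z) h ->
  exists r, bil_to p M (perp_val g) h r.
Proof.
move=> /pairing_functional -/(_ p_sep) [ev lev evP]; exists (ev (phi g)) => n a b ga hb.
rewrite -bilin_endo.
have := pairs_to_approx (pairs_toC (evP (phi (finite_vec p Z a)))) hb.
move=> /pdvd_trans; apply; apply: pdvdBC.
have lf : functional (ev \o phi) by move=> c x y; rewrite /= linearP lev.
have := functional_approx p0 lf ga.
rewrite -(poly_functional (g := fun a => (ev \o phi) (finite_vec p Z a))) //.
by move=> c x y; rewrite finite_vecZD lf.
Qed.

Variables ys xs : seq (sqn R).
Hypothesis ysH : forall y, List.In y ys -> perp p (perp p Z) y.
Hypothesis MP : forall a b : {poly R}, kills ys a -> kills xs b ->
  dotp a (coefs b) = 0 -> bilin M a b = 0.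

(** On finitely supported sequences killing [ys], the form of [d *: phi - q] is
    annihilated by everything that kills [xs]. Both annihilators have finite
    corank, and continuity extends the conclusion from finitely supported
    sequences to the whole module, so [phi] is [q / d] up to finite rank. *)
Lemma endo_scalar_plus_finite : exists2 d, d != 0 & exists q l, forall g,
  qspan l (perp_val (d *: phi g - q *: g)).
Proof.
have [d d0 [q dq]] := bilin_proportional MP.
pose theta : {linear V -> V} := (d \*: phi) \- (q \*: idfun).
have thetaE g : theta g = d *: phi g - q *: g by [].
have lam_lin (b : {poly R}) : functional (fun g => dotp b (perp_val (theta g))).
  by move=> c g g'; rewrite linearP -(dotp_functionalr b).
have theta_fin (a b : {poly R}) : kills ys a -> kills xs b ->
    dotp b (perp_val (theta (finite_vec p Z a))) = 0.
  move=> ka kb; rewrite [perp_val _](_ : _ =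
    d *: perp_val (phi (finite_vec p Z a)) - q *: coefs a) //.
  have lb := dotp_functionalr b; rewrite (functionalB lb) !(functionalZ lb).
  by rewrite bilin_endo dq // (dotpC a) subrr.
(* The functional [g |-> dotp b (theta g)] is a combination of [ys] over the field
   of fractions, first on finitely supported sequences, then by continuity. *)
have theta_ker g (b : {poly R}) :
    (forall y, List.In y ys -> pairs_to p (perp_val g) y 0) ->
    kills xs b -> dotp b (perp_val (theta g)) = 0.
  move=> gK kb; have gl := functional_pairs p0 g ZD (lam_lin b).
  have [|c c0 sc] := @qspan_of_kills _ ys (fun i => dotp b (perp_val (theta (unitv i)))).
    move=> a ka; rewrite -(poly_functional
      (g := fun a => dotp b (perp_val (theta (finite_vec p Z a))))) ?theta_fin //.
    by move=> k a' b'; rewrite finite_vecZD lam_lin.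
  have := pairs_to_span gK sc => /(pairs_to_uniq p_sep) e.
  have /eqP := e _ (pairs_toC (pairs_toZ c (pairs_toC gl))).
  by rewrite eq_sym mulf_eq0 (negbTE c0) => /eqP.
have theta_span g : (forall y, List.In y ys -> pairs_to p (perp_val g) y 0) ->
    qspan xs (perp_val (theta g)).
  by move=> gK; apply: qspan_of_kills => b; exact: theta_ker.
have /choice [ev evP] y : exists f : V -> R, functional f /\
    (perp p (perp p Z) y -> forall g, pairs_to p (perp_val g) y (f g)).
  have [/pairing_functional [//|f lf fP]|yH] := pselect (perp p (perp p Z) y).
    by exists f.
  by exists (fun=> 0); split=> // c x x'; rewrite mulr0 addr0.
have [|ws wsP] := @ker_corank R V (map ev ys).
  by move=> f /List.in_map_iff [y [<- _]]; have [] := evP y.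
exists d => //; exists q, (xs ++ [seq perp_val (theta w) | w <- ws]) => g.
rewrite -thetaE.
have [c c0 [u su uK]] := wsP g; apply: (qspan_div c0).
have -> : c *: perp_val (theta g) =
    1 *: perp_val (theta (c *: g - u)) + perp_val (theta u).
  rewrite scale1r -[RHS]/(perp_val (theta (c *: g - u) + theta u)) -linearD subrK.
  by rewrite linearZ.
apply: qspanZD.
  have [|c' c'0 sc'] := @theta_span (c *: g - u).
    move=> y y_in; rewrite -(uK (ev y)); last exact: List.in_map.
    by apply: (evP y).2; exact: ysH.
  by exists c' => //; exact: span_catl.
apply: span_qspan; apply: span_catr.
apply: (span_map (f := fun w => perp_val (theta w))) => // a x y.
by rewrite linearP.
Qed.

Hypothesis phi_inj : injective phi.

(** A relation between iterates of [phi], after cancelling a power of the injective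
    [phi], has a nonzero constant term. *)
Lemma iter_relation l x : has (fun c => c != 0) l ->
    foldr (fun c acc => c *: x + phi acc) 0 l = 0 ->
  exists2 c : R, c != 0 & exists y, c *: x = phi y.
Proof.
elim: l => //= c l IH; have [->|c0 _] := eqVneq c 0.
  rewrite scale0r add0r /= => hl e; apply: IH => //.
  by apply: phi_inj; rewrite e raddf0.
move=> /eqP; rewrite addr_eq0 => /eqP e; exists c => //.
by eexists; rewrite e -raddfN.
Qed.

Lemma foldr_iter n (v : nat -> R) x :
  \sum_(i < n) v i *: iter i phi x =
  foldr (fun c acc => c *: x + phi acc) 0 (mkseq v n).
Proof.
elim: n v => [|n IH] v; first by rewrite big_ord0.
rewrite big_ord_recl /= -[iota 1 n]/(iota (1 + 0) n) iotaDl -map_comp.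
rewrite -[map _ _]/(mkseq (v \o succn) n) -IH linear_sum; congr (_ + _).
by apply: eq_bigr => i _; rewrite linearZ.
Qed.

(** Index zero: with [d *: phi] equal to [q] plus finite rank, the elements
    dependent on [l] form a [phi]-invariant space of finite rank, on which the
    injective [phi] has torsion cokernel; for [e] this yields the claim unless
    [q = 0], and then [phi] itself would have finite rank. *)
Theorem endo_cokernel_torsion e :
  exists2 c : R, c != 0 & exists x, c *: e = phi x.
Proof.
have [d d0 [q [l dq]]] := endo_scalar_plus_finite.
pose E (g : V) := qspan l (perp_val g).
have EZD a x y : E x -> E y -> E (a *: x + y) by exact: qspanZD.
have Ephi x : E x -> E (phi x).
  move=> Ex; apply: (qspan_div d0).
  have /(EZD q _ _ Ex) : E (d *: phi x - q *: x) by exact: dq.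
  by rewrite addrC subrK.
have Ecok x : E x -> exists2 c : R, c != 0 & exists y, c *: x = phi y.
  move=> Ex; have [i|v [i vi] v0] :=
      @qspan_dependent _ _ l (fun i => perp_val (iter i phi x)).
    by elim: i => //= i; exact: Ephi.
  pose w j := if insub j is Some i then v i else 0.
  have wE (j : 'I_(size l).+1) : w j = v j by rewrite /w valK.
  apply: (@iter_relation (mkseq w (size l).+1)).
    apply/hasP; exists (w i); last by rewrite wE.
    by apply: map_f; rewrite mem_iota ltn_ord.
  rewrite -foldr_iter; apply: val_inj => /=.
  rewrite -[RHS]v0; elim/big_rec2: _ => // j y z _ <-.
  by rewrite wE.
have [c c0 [y cy]] : exists2 c : R, c != 0 & exists y, c *: (d *: phi e - q *: e) = phi y.
  by apply: Ecok; exact: dq.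
have [q0|q0] := eqVneq q 0; last first.
  exists (c * q); first by rewrite mulf_neq0.
  exists (c *: (d *: e) - y); rewrite raddfB /= !linearZ /= -cy scalerBr opprB.
  by rewrite addrC subrK scalerA.
have Eall g : E (phi g).
  apply: (qspan_div d0); have := dq g; rewrite q0 scale0r subr0; exact.
have [i|v [i /eqP vi] v0] := @qspan_dependent _ _ l (fun i => perp_val (phi (unitv i))).
  exact: Eall.
case: vi; apply: coefs_Xn_free.
have /phi_inj /(congr1 (@perp_val _ _ _)) e0 : phi (\sum_i v i *: unitv i) = phi 0.
  rewrite raddf0 raddf_sum; apply: val_inj; rewrite -[RHS]v0 /=.
  by elim/big_rec2: _ => // j y' z _ <-; rewrite linearZ.
by rewrite -[RHS]e0; elim/big_rec2: _ => // j y' z _ ->.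
Qed.

End FiniteRank.

(** * The transfinite construction *)

Section WellOrder.
Variables (W : Type) (le : rel W).
Hypothesis le_wo : well_order le.

Definition below y x := le y x /\ y <> x.

Lemma wo_min (P : W -> Prop) : (exists x, P x) ->
  exists2 m, P m & forall x, P x -> le m x.
Proof.
move=> [x Px]; have [|m [[/asboolP Pm mP] _]] := le_wo (A := [pred x | `[< P x >]]).
  by exists x; apply/asboolP.
by exists m => // y Py; apply: mP; apply/asboolP.
Qed.

Lemma wo_refl x : le x x.
Proof. by have [|m -> mP] := @wo_min (eq x); [exists x|apply: mP]. Qed.

Lemma wo_anti x y : le x y -> le y x -> x = y.
Proof.
move=> xy yx; have [|m [_ uniq]] := le_wo (A := [pred z | `[< z = x \/ z = y >]]).
  by exists x; apply/asboolP; left.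
rewrite -(uniq x) ?(uniq y) //; split; try by apply/asboolP; auto.
  by move=> z /asboolP [] ->; rewrite ?wo_refl.
by move=> z /asboolP [] ->; rewrite ?wo_refl.
Qed.

Lemma wo_total x y : le x y \/ le y x.
Proof.
have [|m mxy mP] := @wo_min (fun z => z = x \/ z = y); first by exists x; left.
by case: mxy => <-; [left|right]; apply: mP; auto.
Qed.

Lemma wo_trans y x z : le x y -> le y z -> le x z.
Proof.
move=> xy yz; have [|m mxyz mP] := @wo_min (fun u => [\/ u = x, u = y | u = z]).
  by exists x; constructor 1.
have mx : le m x by apply: mP; constructor 1.
have my : le m y by apply: mP; constructor 2.
have mz : le m z by apply: mP; constructor 3.
case: mxyz => [<- //|e|e]; first by subst; rewrite (wo_anti xy mx).
by subst; rewrite (wo_anti yz my) in xy *.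
Qed.

Lemma below_trans y x z : below x y -> below y z -> below x z.
Proof.
move=> [xy nxy] [yz nyz]; split; first exact: wo_trans yz.
by move=> xz; subst; apply: nyz; exact: wo_anti.
Qed.

Lemma below_cases x y : [\/ below x y, x = y | below y x].
Proof.
have [->|xy] := pselect (x = y); first by constructor 2.
have [?|?] := wo_total x y; [constructor 1|constructor 3]; split=> //.
exact: nesym.
Qed.

Lemma below_wf : well_founded below.
Proof.
move=> x; apply: contrapT => nx.
have [m nm mP] := @wo_min (fun y => ~ Acc below y) (ex_intro _ x nx).
apply: nm; constructor => y [ym ne]; apply: contrapT => /mP my.
by apply: ne; exact: wo_anti.
Qed.

End WellOrder.

Section Stages.
Variables (R : idomainType) (p : R).
Implicit Types (X Y : set (sqn R)) (M : nat -> sqn R).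

Local Notation orth := (orth p).
Local Notation nullseq := (nullseq p).
Local Notation perp := (perp p).

Hypothesis p0 : p != 0.
Hypothesis p_sep : forall r, (forall n, pdvd p n r) -> r = 0.
Hypothesis p_cancel : forall c, c != 0 ->
  exists k, forall n r, pdvd p (n + k) (c * r) -> pdvd p n r.
Hypothesis R_countable : countable [set: R].

Definition orth_pair X Y := [/\ countable X /\ countable Y, X `<=` nullseq,
  Y `<=` nullseq & X `<=` perp Y].

Lemma orth_pairC X Y : orth_pair X Y -> orth_pair Y X.
Proof.
move=> [[cX cY] XD YD XY]; split=> // y Yy x Xx.
by apply: orthC; exact: XY.
Qed.

Lemma orth_pair_add X Y g : orth_pair X Y -> nullseq g -> perp Y g ->
  orth_pair (g |` X) Y.
Proof.
move=> [[cX cY] XD YD XY] gD gY; split=> //.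
- split=> //; rewrite -bigcup2E; apply: bigcup_countable => // -[|[|i]] _ /=.
  + exact: countable1.
  + exact: cX.
  + exact: countable0.
- by move=> x [->|/XD].
- by move=> x [->|/XY].
Qed.

(** The first case excludes that [M] is the matrix of an endomorphism of
    [perp Y]; in the second case such an endomorphism is a scalar plus finite
    rank. *)
Definition settled X Y M :=
  (exists g h, [/\ X g, Y h & ~ exists r, bil_to p M g h r]) \/
  exists ys xs, (forall y, List.In y ys -> Y y \/ exists a, y = coefs (a : {poly R})) /\
    (forall a b : {poly R}, kills ys a -> kills xs b -> dotp a (coefs b) = 0 ->
      bilin M a b = 0).

Lemma settledS X Y X' Y' M : X `<=` X' -> Y `<=` Y' ->
  settled X Y M -> settled X' Y' M.
Proof.
move=> XX' YY' [[g [h [Xg Yh no]]]|[ys [xs [ysP MP]]]].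
  by left; exists g, h; split=> //; [exact: XX'|exact: YY'].
right; exists ys, xs; split=> // y /ysP [Yy|]; [by left; exact: YY'|by right].
Qed.

(** The stage handles the sequence [M 0] and the matrix [M], enlarges [X]
    properly, and leaves the pair [z], [h] for the choice made by the branch. *)
Definition stage_spec X Y M X' Y' (z h : sqn R) :=
  [/\ orth_pair X' Y', X `<=` X' /\ Y `<=` Y',
      ~ nullseq (M 0%N) ->
        (exists2 x, X' x & ~ orth x (M 0%N)) /\ (exists2 y, Y' y & ~ orth y (M 0%N)),
      settled X' Y' M /\ (exists2 x, X' x & ~ X x) &
      [/\ nullseq z, nullseq h, perp Y' z, perp X' h & ~ orth z h]].

Let add_killer X Y w : orth_pair X Y -> exists2 X',
  orth_pair X' Y /\ X `<=` X' & ~ nullseq w -> exists2 x, X' x & ~ orth x w.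
Proof.
move=> XY; have [wD|wD] := pselect (nullseq w).
  by exists X => //; split=> // x.
have [[_ cY] _ YD _] := XY.
have [g [gD gY gw]] := kill_sequence p0 p_sep p_cancel R_countable cY YD wD.
exists (g |` X); last by move=> _; exists g => //; left.
by split; [exact: orth_pair_add|by move=> x; right].
Qed.

Lemma stage_exists X Y M : orth_pair X Y ->
  exists X' Y' z h, stage_spec X Y M X' Y' z h.
Proof.
move=> XY0.
have [X1 [XY1 X01] X1w] := add_killer (M 0%N) XY0.
have [Y1 [/orth_pairC XY2 Y01] Y1w] := add_killer (M 0%N) (orth_pairC XY1).
have [X2 [XY3 X12] [x X2x Xx]] : exists2 X2,
    orth_pair X2 Y1 /\ X1 `<=` X2 & exists2 x, X2 x & ~ X x.
  have [[cX cY] _ _ _] := XY2.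
  have [g [h [[gD _] gY hX gh]]] := new_pair p0 p_sep R_countable cX cY.
  exists (g |` X1); first by split; [exact: orth_pair_add|by move=> x; right].
  exists g; first by left.
  by move=> /X01 X1g; apply: gh; apply: orthC; exact: hX.
have [X3 [Y3 [XY4 X23 Y13 MP]]] : exists X3 Y3,
    [/\ orth_pair X3 Y3, X2 `<=` X3, Y1 `<=` Y3 & settled X3 Y3 M].
  have [[cX cY] _ _ _] := XY3.
  have [[g [h [[gD hD] gY hX gh no]]]|trivial] :=
    kill_matrix p0 p_sep R_countable M cX cY.
    exists (g |` X2), (h |` Y1); split; [|by move=> ?; right|by move=> ?; right|].
      apply/orth_pairC/orth_pair_add => //.
        by apply/orth_pairC; exact: orth_pair_add.
      by move=> y [->|/hX //]; exact: orthC.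
    by left; exists g, h; split=> //; left.
  by exists X2, Y1; split=> //; right.
have [[cX cY] _ _ _] := XY4.
have [z [h [[zD hD] zY hX zh]]] := new_pair p0 p_sep R_countable cX cY.
exists X3, Y3, z, h; split=> //.
- by split=> [u /X01/X12/X23|u /Y01/Y13].
- move=> wD; split; first by have [u /X12/X23] := X1w wD; exists u.
  by have [u /Y13] := Y1w wD; exists u.
- by split=> //; exists x => //; exact: X23.
Qed.

Variables (W : Type) (le : rel W).
Hypothesis le_wo : well_order le.
Local Notation below := (below le).
Hypothesis segment_countable : forall x, countable [set y | below y x].

(* Every stage handles one matrix, and through its row 0 one sequence. *)
Variable matrix_at : W -> nat -> sqn R.
Hypothesis matrix_at_surj : forall M, exists w, matrix_at w = M.

Let stage_choice : exists F : set (sqn R) * set (sqn R) * W ->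
    set (sqn R) * set (sqn R) * sqn R * sqn R, forall XY w,
  orth_pair XY.1 XY.2 -> let: (X', Y', z, h) := F (XY, w) in
  stage_spec XY.1 XY.2 (matrix_at w) X' Y' z h.
Proof.
have /choice [F FP] (XYw : set (sqn R) * set (sqn R) * W) :
    exists s : set (sqn R) * set (sqn R) * sqn R * sqn R,
    orth_pair XYw.1.1 XYw.1.2 ->
    stage_spec XYw.1.1 XYw.1.2 (matrix_at XYw.2) s.1.1.1 s.1.1.2 s.1.2 s.2.
  have [ok|nok] := pselect (orth_pair XYw.1.1 XYw.1.2).
    have [X' [Y' [z [h spec]]]] := stage_exists (matrix_at XYw.2) ok.
    by exists (X', Y', z, h).
  by exists (set0, set0, 0, 0) => /nok.
exists F => XY w ok; have := FP (XY, w) ok.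
by case: (F _) => [[[X' Y'] z] h].
Qed.

(** The recursion follows a branch [A] of the binary tree of height [W]: each
    stage ends with a pair [z], [h] that is not orthogonal, and puts [z] on the
    left if [A] holds there, [h] on the right otherwise. Two branches agree up to
    their first difference, and there one of the modules contains [z] while the
    other one excludes it, so distinct branches give distinct modules. *)
Theorem tree_construction : exists XX YY : (W -> Prop) -> set (sqn R), forall A,
  [/\ perp (XX A) `<=` nullseq /\ perp (YY A) `<=` nullseq,
      XX A `<=` perp (YY A),
      exists2 f : W -> sqn R, injective f & forall w, XX A (f w),
      forall M, settled (XX A) (YY A) M &
      forall A', perp (YY A) = perp (YY A') -> A = A'].
Proof.
have [F FP] := stage_choice.
pose grow (A : W -> Prop) w (XY : set (sqn R) * set (sqn R)) :=
  let: (X, Y, z, h) := F (XY, w) in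
  if `[< A w >] then (z |` X, Y) else (X, h |` Y).
pose before w (st : forall v, below v w -> set (sqn R) * set (sqn R)) :=
  ([set x | exists v (vw : below v w), (st v vw).1 x],
   [set y | exists v (vw : below v w), (st v vw).2 y]).
pose stage A := Fix (below_wf le_wo) (fun=> _)
  (fun w st => grow A w (before w st)).
pose past A w := before w (fun v _ => stage A v).
have stageE A w : stage A w = grow A w (past A w).
  rewrite /stage Fix_eq // => u s s' ss'; congr (grow A u _).
  have -> // : s = s'.
  by do 2!apply: functional_extensionality_dep => ?.
pose ok (XY : set (sqn R) * set (sqn R)) := orth_pair XY.1 XY.2.
have past_stage A w : ok (past A w) ->
    (past A w).1 `<=` (stage A w).1 /\ (past A w).2 `<=` (stage A w).2.
  move=> okw; have := FP _ w okw; rewrite stageE /grow.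
  case: (F _) => [[[X' Y'] z] h] [_ [XX' YY'] _ _ _].
  case: asboolP => _; split=> u //=.
  - by move/XX'; right.
  - by move/YY'.
  - by move/XX'.
  - by move/YY'; right.
have stage_ok A w : ok (past A w) -> ok (stage A w).
  move=> okw; have := FP _ w okw; rewrite stageE /grow /ok.
  case: (F _) => [[[X' Y'] z] h] [ok' _ _ _ [zD hD zY hX _]].
  case: asboolP => _ /=; first exact: orth_pair_add.
  by apply/orth_pairC/orth_pair_add => //; exact/orth_pairC.
have stage_past A v w : below v w ->
    (stage A v).1 `<=` (past A w).1 /\ (stage A v).2 `<=` (past A w).2.
  by move=> vw; split=> x vx; exists v, vw.
have stage_orth A u v : ok (past A u) -> ok (past A v) ->
    (stage A u).1 `<=` perp (stage A v).2.
  move=> oku okv x ux y vy.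
  have [_ _ _ XYu] := stage_ok _ _ oku; have [_ _ _ XYv] := stage_ok _ _ okv.
  have [uv|uv|vu] := below_cases le_wo u v.
  - by apply: XYv => //; apply: (past_stage A v okv).1; exact: (stage_past A u v uv).1.
  - by apply: XYv => //; rewrite -uv.
  - by apply: XYu => //; apply: (past_stage A u oku).2; exact: (stage_past A v u vu).2.
have past_ok A w : ok (past A w).
  elim/(well_founded_ind (below_wf le_wo)): w => w IH.
  have stage_ok_below v : below v w -> ok (stage A v) by move=> /IH; exact: stage_ok.
  have past_countable (C : W -> set (sqn R)) :
      (forall v, below v w -> countable (C v)) ->
      countable [set x | exists v (_ : below v w), C v x].
    move=> cC; rewrite [X in countable X](_ : _ =
      \bigcup_(v in [set v | below v w]) C v); first exact: bigcup_countable.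
    apply/seteqP; split=> x; first by move=> [v [vw Cx]]; exists v.
    by move=> [v vw Cx]; exists v, vw.
  split=> /=.
  - by split; apply: past_countable => v /stage_ok_below [[]].
  - by move=> x [v [/stage_ok_below [_ XD _ _] /XD]].
  - by move=> y [v [/stage_ok_below [_ _ YD _] /YD]].
  - by move=> x [u [uw ux]] y [v [vw vy]]; exact: (stage_orth A u v (IH u uw) (IH v vw)).
pose XX A : set (sqn R) := [set x | exists w, (stage A w).1 x].
pose YY A : set (sqn R) := [set y | exists w, (stage A w).2 y].
have stageP A w : exists X' Y' z h,
    [/\ stage_spec (past A w).1 (past A w).2 (matrix_at w) X' Y' z h,
        F (past A w, w) = (X', Y', z, h), X' `<=` (stage A w).1,
        X' `<=` XX A & Y' `<=` YY A].
  have := FP _ w (past_ok A w); rewrite stageE /grow.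
  case FE : (F _) => [[[X' Y'] z] h] spec; exists X', Y', z, h; split=> // x X'x.
  - by case: asboolP => _ //=; right.
  - by exists w; rewrite stageE /grow FE; case: asboolP => _ //=; right.
  - by exists w; rewrite stageE /grow FE; case: asboolP => _ //=; right.
have orthXY A : XX A `<=` perp (YY A).
  by move=> x [u ux] y [v vy]; exact: (stage_orth A u v (past_ok A u) (past_ok A v)).
exists XX, YY => A; split.
- have killed w : ~ nullseq w -> (exists2 x, XX A x & ~ orth x w) /\
      exists2 y, YY A y & ~ orth y w.
    move=> wD; have [v vw] := matrix_at_surj (fun=> w).
    have [X' [Y' [z [h [[_ _ kill _ _] _ _ XX' YY']]]]] := stageP A v.
    rewrite vw in kill; have [[x /XX' Xx xw] [y /YY' Yy yw]] := kill wD.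
    by split; [exists x|exists y].
  split=> w wP; apply: contrapT => /killed [[x Xx xw] [y Yy yw]].
    by apply: xw; apply: orthC; exact: wP.
  by apply: yw; apply: orthC; exact: wP.
- exact: orthXY.
- have /choice [f fP] w : exists x, (stage A w).1 x /\ ~ (past A w).1 x.
    have [X' [Y' [z [h [[_ _ _ [_ [x X'x nx]] _] _ X'S _ _]]]]] := stageP A w.
    by exists x; split=> //; exact: X'S.
  exists f => [u v fuv|w]; last by exists w; exact: (fP w).1.
  have [uv|//|vu] := below_cases le_wo u v.
    by case: (fP v).2; rewrite -fuv; apply: (stage_past A u v uv).1; exact: (fP u).1.
  by case: (fP u).2; rewrite fuv; apply: (stage_past A v u vu).1; exact: (fP v).1.
- move=> M; have [w <-] := matrix_at_surj M.
  have [X' [Y' [z [h [[_ _ _ [sM _] _] _ _ XX' YY']]]]] := stageP A w.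
  exact: settledS sM.
move=> A' AA'; apply: contrapT => neq.
have [w nw wmin] : exists2 w, ~ (A w <-> A' w) &
    forall v, ~ (A v <-> A' v) -> le w v.
  apply: (wo_min le_wo); apply/existsNP => same; apply: neq.
  by apply/funext => w; exact/propext.
have past_eq u : (forall v, below v u -> stage A v = stage A' v) ->
    past A u = past A' u.
  move=> e; congr (_, _); apply/seteqP;
    by split=> x [v [vu vx]]; exists v, vu; move: vx; rewrite e.
have agree v : below v w -> stage A v = stage A' v.
  elim/(well_founded_ind (below_wf le_wo)): v => v IH vw.
  rewrite !stageE past_eq => [|u uv]; last first.
    by apply: IH => //; exact: below_trans vw.
  have -> // : grow A v = grow A' v.
  have Av : A v = A' v.
    apply/propext; apply: contrapT => /wmin wv.
    by case: vw => vw; apply; exact: (wo_anti le_wo).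
  by rewrite /grow Av.
have [X' [Y' [z [h [[_ _ _ _ [_ _ _ _ zh]] FE _ _ _]]]]] := stageP A w.
have zX B : past B w = past A w -> B w -> XX B z.
  by move=> e Bw; exists w; rewrite stageE e /grow FE; case: asboolP => // _; left.
have hY B : past B w = past A w -> ~ B w -> YY B h.
  by move=> e Bw; exists w; rewrite stageE e /grow FE; case: asboolP => // _; left.
have past_w : past A' w = past A w by rewrite (past_eq w agree).
have [Aw|nAw] := pselect (A w).
  have nA'w : ~ A' w by move=> A'w; apply: nw.
  apply: zh; have : perp (YY A) z by apply: orthXY; exact: zX.
  by rewrite AA'; apply; exact: hY.
have A'w : A' w by apply: contrapT => nA'w; apply: nw.
apply: zh; have : perp (YY A') z by apply: orthXY; exact: zX.
by rewrite -AA'; apply; exact: hY.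
Qed.

End Stages.

(** * Counting isomorphism classes *)

Section Counting.
Variables (R : idomainType) (p : R).
Hypothesis p0 : p != 0.
Hypothesis p_sep : forall r, (forall n, pdvd p n r) -> r = 0.

Local Notation perp := (perp p).
Local Notation perp_module := (perp_module p).

Definition hom_matrix Z Z' (f : {linear perp_module Z -> perp_module Z'}) :
    nat -> sqn R :=
  fun i => perp_val (f (finite_vec p Z 'X^i)).

(** Homomorphisms are continuous, hence determined on unit vectors. *)
Lemma hom_matrix_inj Z Z1 Z2 (f1 : {linear perp_module Z -> perp_module Z1})
    (f2 : {linear perp_module Z -> perp_module Z2}) :
    perp Z `<=` nullseq p -> hom_matrix f1 = hom_matrix f2 ->
  forall g, perp_val (f1 g) = perp_val (f2 g).
Proof.
move=> ZD f12 g; apply/funext => j.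
have lin Z' (f : {linear perp_module Z -> perp_module Z'}) :
    functional (fun g => perp_val (f g) j) by move=> a x y; rewrite linearP.
have P1 := functional_pairs p0 g ZD (lin _ f1).
have P2 := functional_pairs p0 g ZD (lin _ f2).
apply: (pairs_to_uniq p_sep P1).
rewrite [X in pairs_to _ _ X](_ : _ =
  (fun i => perp_val (f2 (finite_vec p Z 'X^i)) j)) //.
by apply/funext => i; exact: (congr1 (fun M : nat -> sqn R => M i j) f12).
Qed.

(** The matrix determines the isomorphism as a map into sequences, and the target
    is its image. *)
Lemma iso_target_determined Z Z1 Z2 (f1 : {linear perp_module Z -> perp_module Z1})
    (f2 : {linear perp_module Z -> perp_module Z2}) :
    perp Z `<=` nullseq p -> bijective f1 -> bijective f2 ->
  hom_matrix f1 = hom_matrix f2 -> perp Z1 = perp Z2.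
Proof.
move=> ZD [g1 _ f1K] [g2 _ f2K] f12.
have e := hom_matrix_inj ZD f12.
apply/seteqP; split=> x xZ.
  have := perp_valK (f2 (g1 (to_perp xZ))); rewrite -e f1K; exact.
by have := perp_valK (f1 (g2 (to_perp xZ))); rewrite e f2K; exact.
Qed.

End Counting.

Lemma isomorphic_sym (R : pzRingType) (U V : lmodType R) :
  isomorphic U V -> isomorphic V U.
Proof.
move=> [f [g fK gK]]; pose G : V -> U := g.
have Glin : linear G by move=> a x y; apply: (can_inj fK); rewrite linearP !gK.
exists (HB.pack_for {linear V -> U} G (GRing.isLinear.Build _ _ _ _ G Glin)).
by exists f.
Qed.

Lemma isomorphic_refl (R : pzRingType) (U : lmodType R) : isomorphic U U.
Proof. by exists idfun; exists idfun. Qed.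

Lemma isomorphic_trans (R : pzRingType) (U V X : lmodType R) :
  isomorphic U V -> isomorphic V X -> isomorphic U X.
Proof.
move=> [f fb] [g gb]; exists (g \o f : {linear U -> X}); exact: bij_comp.
Qed.

(** Koenig's diagonal argument. A branch codes a family of branches indexed by
    [W]. If for every [w] some branch differed from the [w]-th component of the
    [w]-th member of each class, the family of these branches would belong to no
    class. *)
Lemma many_classes (W : Type) (pair : W -> W -> W)
    (pairI : forall u v u' v', pair u v = pair u' v' -> u = u' /\ v = v')
    (E : (W -> Prop) -> (W -> Prop) -> Prop)
    (Erefl : forall A, E A A) (Esym : forall A B, E A B -> E B A)
    (Etrans : forall A B C, E A B -> E B C -> E A C)
    (F : (W -> Prop) -> W -> (W -> Prop))
    (FP : forall A B, E A B -> exists w, F A w = B) :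
  exists S : set W -> (W -> Prop), forall I J, E (S I) (S J) -> I = J.
Proof.
pose rep A : set W := xget set0 (E A).
have repE A : E A (rep A) by apply: (@xgetPex _ set0 (E A)); exists A.
have rep_eq A B : E (rep A) (rep B) -> rep A = rep B.
  move=> AB; have EAB : E A B.
    exact: Etrans _ _ _ (repE A) (Etrans _ _ _ AB (Esym _ _ (repE B))).
  congr xget; apply/funext => C; apply/propext; split; last exact: Etrans.
  exact/Etrans/Esym.
have [w0 /choice [S SP]] : exists w0, forall I : set W, exists A : W -> Prop,
    (fun v => F (rep A) w0 (pair w0 v)) = I.
  apply: contrapT => /forallNP no.
  have /choice [I IP] w : exists I : set W, forall A : W -> Prop,
      (fun v => F (rep A) w (pair w v)) <> I.
    by have /existsNP [I noI] := no w; exists I => A AI; apply: noI; exists A.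
  pose A u := exists w v, u = pair w v /\ I w v.
  have [w FA] := FP _ _ (Esym _ _ (repE A)).
  apply: (IP w A); rewrite FA; apply/funext => v; apply/propext; split.
    by move=> [w' [v' [/pairI [<- <-]]]].
  by exists w, v.
exists (rep \o S) => I J /rep_eq SIJ.
by rewrite -(SP I) -(SP J) [rep (S I)]SIJ.
Qed.

Lemma pair_set_nat : exists pair : set nat -> set nat -> set nat,
  forall u v u' v', pair u v = pair u' v' -> u = u' /\ v = v'.
Proof.
exists (fun u v n => if odd n then u n./2 else v n./2) => u v u' v' e.
split; apply/funext => n.
  by have := congr1 (fun f : set nat => f n.*2.+1) e; rewrite /= odd_double /= uphalf_double.
by have := congr1 (fun f : set nat => f n.*2) e; rewrite /= odd_double doubleK.
Qed.

Lemma card_aleph1_of_injections (T W : Type) (f : T -> W) (g : W -> T) :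
  injective f -> injective g -> card_aleph1 W -> card_aleph1 T.
Proof.
move=> fI gI [le [le_wo W_unc seg]].
exists (fun x y => le (f x) (f y)); split.
- move=> A [x Ax].
  have [|m [[/asboolP [y Ay ym] mP] uniq]] :=
      le_wo [pred w | `[< exists2 x, x \in A & f x = w >]].
    by exists (f x); apply/asboolP; exists x.
  exists y; split.
    split=> // z Az; rewrite ym; apply: mP; apply/asboolP; by exists z.
  move=> z [Az zP]; apply: fI; rewrite ym; apply: uniq; split.
    by apply/asboolP; exists z.
  by move=> w /asboolP [x' Ax' <-]; exact: zP.
- move=> /countable_injP [h hI]; apply: W_unc; apply/countable_injP.
  exists (h \o g) => u v _ _ /= /hI; rewrite !inE => guv; exact/gI/guv.
- move=> x; have /countable_injP [h hI] := seg (f x); apply/countable_injP.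
  exists (h \o f) => u v; rewrite !inE => -[xu ne] [xv ne'] /= huv.
  by apply/fI/hI => //; rewrite inE /=; split=> // /fI.
Qed.

Lemma matrix_code (R : idomainType) : countable [set: R] ->
  exists code : (nat -> sqn R) -> set nat, injective code.
Proof.
move=> /countable_injP [r rI].
exists (fun M n => exists i j, n = pickle (i, j, r (M i j))) => M M' e.
apply/funext => i; apply/funext => j.
have : exists i' j', pickle (i, j, r (M i j)) = pickle (i', j', r (M' i' j')).
  rewrite -[exists _, _]/((fun n => exists i' j',
    n = pickle (i', j', r (M' i' j'))) _) -e.
  by exists i, j.
move=> [i' [j' /(pcan_inj pickleK) [<- <-]]].
by apply: rI; rewrite inE.
Qed.

(** * The theorem *)

Theorem theorem1p3 (CH : continuum_hypothesis)
    (R : idomainType)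
    (R_countable : countable [set: R])
    (R_pid : principal_ideal_domain R)
    (R_not_field : ~ GRing.field_axiom R) :
  exists (I : Type) (G : I -> lmodType R),
    [/\ card_two_pow_aleph1 I,
        (forall i j : I, i <> j -> ~ isomorphic (G i) (G j)) &
        forall i : I,
          [/\ reflexive_module (G i),
              card_aleph1 (G i) &
              ~ isomorphic (G i) (R^o * G i)%type]].
Proof.
have [p [p0 pU]] : exists p : R, p != 0 /\ p \isn't a GRing.unit.
  have /existsNP [p /not_implyP [p0 pU]] := R_not_field.
  by exists p; split=> //; apply/negP.
have p_sep := pid_adic_separated R_pid p0 pU.
have p_cancel := pid_adic_cancel R_pid p.
have [code code_inj] := matrix_code R_countable.
have [matrix_at matrixK] : exists f : set nat -> nat -> sqn R, cancel code f.
  have /choice [f fP] (w : set nat) : exists M, (exists M', code M' = w) -> code M = w.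
    have [[M Mw]|no] := pselect (exists M', code M' = w); first by exists M.
    by exists (fun=> 0) => /no.
  by exists f => M; apply: code_inj; apply: fP; exists M.
have matrix_surj M : exists w, matrix_at w = M by exists (code M).
have [le [le_wo _ segments]] := CH.
have [XX [YY tree]] := tree_construction p0 p_sep p_cancel R_countable le_wo
  segments matrix_surj.
have YD A : perp p (YY A) `<=` nullseq p by have [[]] := tree A.
have YYD A : perp p (perp p (YY A)) `<=` nullseq p.
  have [[XD _] XY _ _ _] := tree A.
  exact: subset_trans (perpS XY) XD.
pose G A : lmodType R := perp_module p (YY A).
(* [F (A, w)] is the branch reached from [A] by an isomorphism with matrix
   [matrix_at w]. *)
have /choice [F FP] (Aw : (set nat -> Prop) * set nat) : exists B : set nat -> Prop,
    forall B', (exists2 f : {linear G Aw.1 -> G B'}, bijective f &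
      hom_matrix f = matrix_at Aw.2) -> B = B'.
  case: Aw => A w /=.
  have [[B [f fb fw]]|no] := pselect (exists B, exists2 f : {linear G A -> G B},
      bijective f & hom_matrix f = matrix_at w); last first.
    by exists A => B' fB'; case: no; exists B'.
  exists B => B' [f' f'b f'w]; have [_ _ _ _] := tree B; apply.
  by apply: (iso_target_determined p0 p_sep (YD A) fb f'b); rewrite fw f'w.
have [pair pairI] := pair_set_nat.
have F_cover A B : isomorphic (G A) (G B) -> exists w, F (A, w) = B.
  move=> [f fb]; exists (code (hom_matrix f)); apply: FP.
  by exists f; rewrite // matrixK.
have [S SP] := many_classes pairI (fun A => isomorphic_refl (G A))
  (fun A B => @isomorphic_sym _ (G A) (G B))
  (fun A B C => @isomorphic_trans _ (G A) (G B) (G C)) F_cover.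
exists (set (set nat)), (fun I => G (S I)); split.
- by exists (set nat).
- by move=> I J IJ /SP.
move=> I; move: (S I) => A {SP S I}.
have [_ XY [x x_inj xX] settledA _] := tree A.
split; first exact: (perp_reflexive p0 p_sep (@YD A) (@YYD A)).
  apply: (@card_aleph1_of_injections (G A) (set nat) (fun g => code (fun=> perp_val g))
    (fun w => to_perp (XY _ (xX w))) _ _ CH).
    by move=> g g' /code_inj e; apply: val_inj; exact: (congr1 (fun M => M 0%N) e).
  by move=> u v /(congr1 (@perp_val _ _ _)) /x_inj.
move=> [f [g fK gK]].
have glin : linear g by move=> a u v; apply: (can_inj fK); rewrite linearP !gK.
(* An isomorphism with [R^o * G] would give an injective endomorphism [phi] of [G]
   with [g (1, 0)] of infinite order modulo its image. *)
pose phi0 (u : G A) : G A := g (0, u).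
have phi0_lin : linear phi0.
  by move=> a u v; rewrite /phi0 -glin; congr (g (_, _)); rewrite /= scaler0 addr0.
pose phi : {linear G A -> G A} :=
  HB.pack_for {linear G A -> G A} phi0 (GRing.isLinear.Build _ _ _ _ phi0 phi0_lin).
have phi_inj : injective phi by move=> u v /(can_inj gK) [].
have [[u [h [Xu Yh []]]]|[ys [xs [ysP trivial]]]] := settledA (hom_matrix phi).
  apply: (endo_bil_to p0 p_sep phi (to_perp (XY _ Xu))).
  exact: sub_perp_perp.
have ysH y : List.In y ys -> perp p (perp p (YY A)) y.
  by move=> /ysP [/(@sub_perp_perp _ p)|[a ->]] //; exact: perp_coefs.
have [c /eqP c0 [v]] := endo_cokernel_torsion p0 p_sep (@YD A) ysH trivial phi_inj
  (g (1, 0)).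
rewrite /= /phi0 => cv; apply: c0.
have : c *: (1 : R^o, 0 : G A) = (0, v).
  by apply: (can_inj gK); rewrite -cv; apply: (can_inj fK); rewrite linearZ !gK.
by move=> [] /=; rewrite /GRing.scale /= mulr1.
Qed.
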